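(* Let $\Gamma$ be a finitely generated group and let $\mathcal{G}=\{G_n\}_{n\in\mathbb{N}}$ be a sofic approximation of $\Gamma$. Then the following are equivalent: (1) $\Gamma$ is amenable; (2) $\mathcal{G}$ has property almost-A; (3) $\mathcal{G}$ is hyperfinite.
   Context: A graph sequence $\mathcal{G}=\{G_n\}_{n\in\mathbb{N}}$ is a sequence of finite connected graphs whose vertex degrees are bounded by a constant $d$ independent of $n$, with $\lim_{n\to\infty}|V(G_n)|=\infty$. Here $V(G)$ and $E(G)$ denote vertex and edge sets; each graph carries its path metric (ignoring orientations). Let $\Gamma$ be a group with finite generating set $S$. Its Cayley graph $Cay(\Gamma,S)$ has vertex set $\Gamma$ and a directed edge labelled $s$ from $g$ to $gs$ for each $s\in S$. A graph sequence $\mathcal{G}=\{G_n\}$ with directed edges labelled by $S$ is a sofic approximation of $\Gamma$ if it Benjamini–Schramm converges to $Cay(\Gamma,S)$: for every $r\in\mathbb{N}$, the proportion of vertices $x\in V(G_n)$ such that the ball $B_r(G_n,x)$ is isomorphic, as a rooted edge-labelled (directed) graph, to the ball $B_r(Cay(\Gamma,S),e)$ around the identity tends to $1$ as $n\to\infty$. Property A: a sequence $\{G_n\}$ of finite graphs of uniformly bounded degree (possibly disconnected) has property A if for every $\epsilon>0$ there exist $S_0>0$ and a function $\xi:\bigsqcup_n V(G_n)\to \ell^1(\bigsqcup_n V(G_n))$, $x\mapsto\xi_x$, such that (1) $\|\xi_x\|_1=1$ for all $x$; (2) $\xi_x$ is supported in the ball of radius $S_0$ about $x$ for the path metric (vertices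 in different graphs or different connected components being regarded as infinitely far apart); (3) $\|\xi_x-\xi_y\|_1<\epsilon$ whenever $(x,y)$ is an edge of some $G_n$. Property almost-A: a graph sequence $\mathcal{G}=\{G_n\}$ has property almost-A if for all $n\in\mathbb{N}$ there exist sets $V_n'\subset V(G_n)$ such that (1) $\lim_{n\to\infty}\frac{|V_n'|}{|V(G_n)|}=0$, and (2) $\mathcal{G}'=\{G_n\setminus V_n'\}_{n\in\mathbb{N}}$ (the graphs obtained by deleting the vertices $V_n'$ and all edges incident to them) has property A. Hyperfiniteness: $\mathcal{G}$ is hyperfinite if for every $\epsilon>0$ there exist a constant $K>0$ and edge sets $E_n^\epsilon\subset E(G_n)$ ($n\in\mathbb{N}$) such that $\lim_{n\to\infty}\frac{|E_n^\epsilon|}{|V(G_n)|}<\epsilon$ and, for every $n$, each connected component of $G_n\setminus E_n^\epsilon$ contains at most $K$ vertices. *)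

(* Defs.v *)
From HB Require Import structures.
From mathcomp Require Import all_boot all_order all_algebra.
From mathcomp Require Import finmap.
From mathcomp Require Import all_classical all_reals all_analysis.

Set Implicit Arguments.
Unset Strict Implicit.
Unset Printing Implicit Defensive.

Import Order.TTheory GRing.Theory Num.Theory.
Import numFieldNormedType.Exports.

Local Open Scope classical_set_scope.
Local Open Scope ring_scope.

(* Directed multigraphs, possibly infinite, with edges labelled by L; loops
   and parallel edges are allowed, as they occur in Cayley graphs (1 \in S,
   or both s and s^-1 in S). *)
Record lgraph (L : Type) := LGraph {
  vertex : choiceType;
  edge : Type;
  src : edge -> vertex;
  tgt : edge -> vertex;
  lab : edge -> L }.

Record flgraph (L : Type) := FGraph {
  fvertex : finType;
  fedge : finType;
  fsrc : fedge -> fvertex;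
  ftgt : fedge -> fvertex;
  flab : fedge -> L }.

Coercion lgraph_of_flgraph L (G : flgraph L) : lgraph L :=
  LGraph (@fsrc L G) (@ftgt L G) (@flab L G).

Section Graphs.
Variable L : Type.
Implicit Types G H : lgraph L.

(* Adjacency ignores orientation. *)
Definition adj G : rel (vertex G) := fun x y =>
  `[< exists e : edge G,
        (src e = x /\ tgt e = y) \/ (src e = y /\ tgt e = x) >].

(* The closed ball for the path metric: [path (adj G) x p] says that x :: p is
   a walk in G, whose length is [size p]. *)
Definition gball G (r : nat) (x : vertex G) : set (vertex G) :=
  [set y | exists p : seq (vertex G),
     [/\ path (adj (G:=G)) x p, last x p = y & (size p <= r)%N]].

Definition connected_graph G :=
  forall x y : vertex G, exists r : nat, gball r x y.

Definition edges_in G (X : set (vertex G)) : set (edge G) :=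
  [set e | X (src e) /\ X (tgt e)].

Section Induced.
Variables (G : lgraph L) (X : set (vertex G)).

Definition induced_src (e : edges_in X) : X :=
  exist _ (src (val e)) (mem_set (set_mem (valP e)).1).

Definition induced_tgt (e : edges_in X) : X :=
  exist _ (tgt (val e)) (mem_set (set_mem (valP e)).2).

Definition induced_subgraph : lgraph L :=
  LGraph induced_src induced_tgt (fun e : edges_in X => lab (val e)).

End Induced.

Definition del_edges G (D : set (edge G)) : lgraph L :=
  LGraph (fun e : ~` D => src (val e)) (fun e : ~` D => tgt (val e))
         (fun e : ~` D => lab (val e)).

Definition disjoint_union (G : nat -> lgraph L) : lgraph L :=
  @LGraph L {n : nat & vertex (G n)} {n : nat & edge (G n)}
    (fun e => existT _ (tag e) (src (tagged e)))
    (fun e => existT _ (tag e) (tgt (tagged e)))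
    (fun e => lab (tagged e)).

Definition rooted_iso G (x : vertex G) H (y : vertex H) :=
  exists (f : vertex G -> vertex H) (g : edge G -> edge H),
    [/\ bijective f, bijective g, f x = y
      & forall e, [/\ src (g e) = f (src e), tgt (g e) = f (tgt e)
                    & lab (g e) = lab e]].

Lemma gball_center G r (x : vertex G) : gball r x x.
Proof. by exists [::]. Qed.

Definition gball_root G r (x : vertex G) : vertex (induced_subgraph (gball r x)) :=
  exist _ x (mem_set (gball_center r x)).

Definition gball_iso r G (x : vertex G) H (y : vertex H) :=
  rooted_iso (gball_root r x) (gball_root r y).

(* A loop contributes 2 to the degree of its vertex. *)
Definition degree (G : flgraph L) (x : fvertex G) : nat :=
  #|[set e | fsrc e == x]%SET| + #|[set e | ftgt e == x]%SET|.

Definition graph_sequence (G : nat -> flgraph L) :=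
  [/\ forall n, connected_graph (G n),
      exists d : nat, forall n (x : fvertex (G n)), (degree x <= d)%N
    & #|fvertex (G n)| @[n --> \oo] --> \oo].

End Graphs.

Section Groups.
Variable Gamma : groupType.

Definition generates (S : {fset Gamma}) :=
  forall H : {pred Gamma}, group_closed H ->
    {subset S <= H} -> forall g, g \in H.

Definition Cay (S : {fset Gamma}) : lgraph S :=
  @LGraph S Gamma (Gamma * S)%type
    (fun e => e.1) (fun e => (e.1 * val e.2)%g) (fun e => e.2).

(* Existence of a left-invariant mean on the bounded functions; the values of
   m on unbounded functions are irrelevant. *)
Definition amenable (R : realType) :=
  exists m : (Gamma -> R) -> R,
    [/\ forall (a : R) (f g : Gamma -> R), bounded_fun f -> bounded_fun g ->
          m (fun x => a * f x + g x) = a * m f + m g,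
        forall f : Gamma -> R, bounded_fun f -> (forall x, 0 <= f x) -> 0 <= m f,
        m (fun=> 1) = 1
      & forall (g : Gamma) (f : Gamma -> R), bounded_fun f ->
          m (fun x => f (g^-1 * x)%g) = m f].

Definition sofic_approximation (R : realType) (S : {fset Gamma})
    (G : nat -> flgraph S) :=
  graph_sequence G /\
  forall r : nat,
    (#|[set x | `[< @gball_iso S r (G n) x (Cay S) 1%g >]]%SET|%:R
       / #|fvertex (G n)|%:R) @[n --> \oo] --> (1 : R).

End Groups.

Section Properties.
Variables (R : realType) (L : Type).

Definition norm1 (T : choiceType) (u : T -> R) : \bar R :=
  \esum_(y in setT) `|u y|%:E.

(* For a sequence of graphs, to be applied to their disjoint union, so that
   balls never meet two different graphs. *)
Definition property_A (G : lgraph L) :=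
  forall eps : R, 0 < eps ->
    exists S0 : nat, (0 < S0)%N /\
    exists xi : vertex G -> vertex G -> R,
      [/\ forall x, norm1 (xi x) = 1%E,
          forall x y, xi x y != 0 -> gball S0 x y
        & forall e : edge G,
            (norm1 (fun y => (xi (src e) y - xi (tgt e) y)%R) < eps%:E)%E].

Definition almost_A (G : nat -> flgraph L) :=
  exists W : forall n, {set fvertex (G n)},
    (#|W n|%:R / #|fvertex (G n)|%:R) @[n --> \oo] --> (0 : R) /\
    property_A (disjoint_union (fun n =>
      @induced_subgraph L (G n) [set x : fvertex (G n) | x \notin W n])).

(* [connect (adj _) x] is the connected component of x. *)
Definition hyperfinite (G : nat -> flgraph L) :=
  forall eps : R, 0 < eps ->
    exists (K : nat) (E : forall n, {set fedge (G n)}),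
      [/\ (0 < K)%N,
          exists2 l : R,
            (#|E n|%:R / #|fvertex (G n)|%:R) @[n --> \oo] --> l & l < eps
        & forall n (x : fvertex (G n)),
            (#|@connect (fvertex (G n))
                 (adj (G := @del_edges L (G n) [set e | e \in E n])) x|
               <= K)%N].

End Properties.

(* Main.v *)
(* The proof goes round the cycle (amenable) => (almost-A) => (hyperfinite) =>
   (amenable); hyperfinite => almost-A has no direct proof, since it fails for
   graph sequences that are not sofic approximations.

   Amenable => almost-A.  An invariant mean yields Folner sets F.  Off the
   vertices whose large balls are not Cayley balls, put A_x = x F, so that
   A_x and A_y nearly coincide for adjacent x and y.  The uniform measure on
   A_x does not live on the graph G \ W obtained by deleting the bad vertices,
   and its path metric is larger anyway; hence each y in A_x is replaced by a
   chosen point of the component of x in {z in G \ W : y in A_z}, whose size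
   is bounded.  Adjacent x, x' with y in both sets get the same point.

   Almost-A => hyperfinite.  For any set H of remaining vertices, averaging
   over y shows that some function x |-> |xi_x(y)| on H, and so (layer cake)
   one of its level sets, has small boundary in H.  Cutting off such sets one
   after the other uses few edges.

   Hyperfinite => amenable.  Some component of the cut graph has small
   boundary and contains a vertex with a large Cayley ball; it is carried over
   to a Folner set of the group. *)

Require Import Defs.
From mathcomp Require Import all_boot all_order all_algebra.
From mathcomp Require Import finmap.
From mathcomp Require Import all_classical all_reals all_analysis.
From mathcomp Require Import lra zify ring.

Set Implicit Arguments.
Unset Strict Implicit.
Unset Printing Implicit Defensive.

Import Order.TTheory GRing.Theory Num.Theory.
Import numFieldNormedType.Exports.

Local Open Scope classical_set_scope.
Local Open Scope ring_scope.

(** * Layer cake inequality for edge cuts *)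

Section LayerCake.
Variables (R : realType) (T : choiceType) (I : Type).
Variables (a b : I -> T) (es : seq I) (A : seq T).
Hypothesis uA : uniq A.

Definition cut_size (F : seq T) : nat :=
  count (fun i => (a i \in F) != (b i \in F)) es.

(* Layer cake: w is a sum of multiples of indicators of its superlevel sets, and
   both sides are additive along this decomposition.  It is peeled off from the
   smallest nonzero value of w. *)
Lemma level_set_cut (c : R) (w : T -> R) :
    (forall F : seq T, uniq F -> {subset F <= A} -> c * (size F)%:R <= (cut_size F)%:R) ->
    (forall x, 0 <= w x) -> (forall x, x \notin A -> w x = 0) ->
  c * (\sum_(x <- A) w x) <= \sum_(i <- es) `|w (a i) - w (b i)|.
Proof.
move=> cutF.
have [n] := ubnP (size [seq x <- A | w x != 0]).
elim: n w => // n IH w le_n w0 wA.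
set F := [seq x <- A | w x != 0] in le_n.
have inF x : (x \in F) = (w x != 0).
  rewrite mem_filter; case: (boolP (x \in A)) => [|/wA ->]; first by rewrite andbT.
  by rewrite eqxx.
have [F0|F_neq0] := eqVneq F [::].
  rewrite big1 ?mulr0 ?sumr_ge0 // => x _; apply/eqP/negPn.
  by rewrite -inF F0.
have [x0 x0F min_x0] : exists2 x0, x0 \in F & forall x, x \in F -> w x0 <= w x.
  elim: (F) F_neq0 => // y s IHs _.
  have [->|/IHs[z zs min_z]] := eqVneq s [::].
    by exists y; rewrite ?inE // => x; rewrite inE => /eqP ->.
  have [yz|/ltW zy] := leP (w y) (w z).
    exists y; rewrite ?inE ?eqxx // => x; rewrite inE => /orP[/eqP -> //|/min_z].
    exact: le_trans.
  exists z; rewrite ?inE ?zs ?orbT // => x; rewrite inE => /orP[/eqP -> //|/min_z //].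
pose m := w x0.
have m_gt0 : 0 < m by rewrite lt_def w0 andbT -inF.
pose w' x := w x - m * (x \in F)%:R.
have w'0 x : 0 <= w' x.
  rewrite /w'; case: (boolP (x \in F)) => xF; last by rewrite mulr0 subr0.
  by rewrite mulr1 subr_ge0 min_x0.
have w'A x : x \notin A -> w' x = 0.
  by move=> /wA wx; rewrite /w' inF wx eqxx mulr0 subr0.
have /IH/(_ w'0 w'A) le_w' : (size [seq x <- A | w' x != 0%R] < n)%N.
  rewrite -ltnS; apply: leq_trans le_n; rewrite ltnS.
  have sub : {subset [seq x <- A | w' x != 0] <= rem x0 F}.
    move=> x; rewrite mem_filter => /andP[w'x xA].
    rewrite mem_rem_uniq ?filter_uniq // !inE inF; apply/andP; split.
      apply: contraNneq w'x => ->.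
      by rewrite /w' x0F mulr1 subrr.
    apply: contraNneq w'x => wx.
    by rewrite /w' inF wx eqxx mulr0 subr0.
  have := uniq_leq_size (filter_uniq _ uA) sub.
  rewrite size_rem // => /leq_ltn_trans; apply.
  by rewrite prednK //; case: (F) F_neq0.
have sumF : \sum_(x <- A) w x = \sum_(x <- A) w' x + m * (size F)%:R.
  have -> : (size F)%:R = \sum_(x <- A) (x \in F)%:R :> R.
    rewrite size_filter -sumn_count sumnE big_map natr_sum; apply: eq_bigr => x _; by rewrite inF.
  by rewrite mulr_sumr -big_split /=; apply: eq_bigr => x _; rewrite /w' subrK.
(* An edge crossing [F] loses exactly [m], since [w] is at least [m] at its inner end and 0 at its
   outer end; the other edges lose nothing. *)
have sume : \sum_(i <- es) `|w (a i) - w (b i)| =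
    \sum_(i <- es) `|w' (a i) - w' (b i)| + m * (cut_size F)%:R.
  rewrite /cut_size -sumn_count sumnE big_map natr_sum mulr_sumr -big_split /=.
  apply: eq_bigr => i _.
  have w'N x : x \notin F -> w x = 0 by rewrite inF negbK => /eqP.
  rewrite /w'; case: (boolP (a i \in F)) => aF; case: (boolP (b i \in F)) => bF /=.
  - rewrite mulr0 addr0; congr `|_|; ring.
  - by rewrite (w'N _ bF) !mulr1 !mulr0 !subr0 !ger0_norm ?w0 ?subr_ge0 ?min_x0 // subrK.
  - rewrite (w'N _ aF) !mulr1 !mulr0 !subr0 !sub0r !normrN.
    by rewrite !ger0_norm ?w0 ?subr_ge0 ?min_x0 // subrK.
  - rewrite mulr0 addr0; congr `|_|; ring.
rewrite sumF sume mulrDr lerD // mulrCA ler_pM2l // cutF ?filter_uniq //.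
by move=> x; rewrite mem_filter => /andP[].
Qed.

End LayerCake.

(** * Bounded functions, continuity and positive parts *)

Lemma bounded_fun_leP (R : realType) (T : Type) (f : T -> R) :
  bounded_fun f <-> exists M : R, forall x, `|f x| <= M.
Proof.
split=> [[M [_ HM]]|[M HM]].
  by exists (M + 1) => x; apply: (HM (M + 1)) => //; rewrite ltrDl.
by exists M; split; [exact: num_real|move=> N /ltW MN x _; exact: le_trans MN].
Qed.

Lemma sum_continuous (R : realType) (T : topologicalType) (I : Type)
    (r : seq I) (F : I -> T -> R) :
  (forall i, continuous (F i)) -> continuous (fun x => \sum_(i <- r) F i x).
Proof.
move=> cF; elim: r => [|i r IH] x.
  by under eq_fun do rewrite big_nil; exact: cst_continuous.
by under eq_fun do rewrite big_cons; apply: continuousD; [exact: cF|exact: IH].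
Qed.

Lemma sqr_continuous (R : realType) (T : topologicalType) (f : T -> R) :
  continuous f -> continuous (fun x => f x ^+ 2).
Proof. by move=> cf x; exact: continuousM (cf x) (cf x). Qed.

Definition posp (R : realType) (u : R) : R := Num.max u 0.

Lemma posp_continuous (R : realType) (T : topologicalType) (f : T -> R) :
  continuous f -> continuous (fun x => posp (f x)).
Proof.
move=> cf x; apply: (@continuous_max R T f (fun=> 0) x (cf x)).
exact: cst_continuous.
Qed.

(** When a + b is positive, it is at most [posp a + b], whose square is the right-hand side. This
    replaces the derivative of the squared positive part in the variational argument below. *)
Lemma posp_sqr_le (R : realType) (a b : R) : posp (a + b) ^+ 2 <= posp a ^+ 2 + 2 * posp a * b + b ^+ 2.
Proof.
have -> : posp a ^+ 2 + 2 * posp a * b + b ^+ 2 = (posp a + b) ^+ 2 by ring.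
rewrite /posp; case: (leP (a + b) 0) => ab.
  by rewrite expr0n /= sqr_ge0.
rewrite ler_pXn2r ?nnegrE ?(ltW ab) //.
  rewrite lerD2r le_max lexx //.
by apply: le_trans (ltW ab) _; rewrite lerD2r le_max lexx.
Qed.

Lemma sum_subset (R : realType) (T : eqType) (A B : seq T) (f : T -> R) :
    uniq A -> uniq B -> {subset A <= B} -> (forall x, x \notin A -> f x = 0) ->
  \sum_(x <- A) f x = \sum_(x <- B) f x.
Proof.
move=> uA uB AB fA; rewrite [RHS](bigID (mem A)) /= [X in _ + X]big1 // addr0.
rewrite -[RHS]big_filter; apply/perm_big/uniq_perm; rewrite ?filter_uniq //.
by move=> x; rewrite mem_filter; case: (boolP (x \in A)) => // /AB ->.
Qed.

(** * From an invariant mean to Folner sets, by flows *)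

Section Folner.
Variables (R : realType) (Gamma : groupType) (S : {fset Gamma}).

(** Left translates are used although Cayley edges multiply on the right: the sets compared later
    are x F and x s F, which differ as F and s F do. *)
Definition folner := forall eps : R, 0 < eps -> exists F : seq Gamma,
  [/\ uniq F, F != [::] & forall s, s \in S ->
     (count (fun h => (s * h)%g \notin F) F)%:R <= eps * (size F)%:R].

Local Notation flow := (prod_topology (fun _ : Gamma * Gamma => R : topologicalType)).

(** [h (s, x)] is the flow along the edge from x to s x, so this is outflow minus inflow. *)
Definition divergence (h : flow) (x : Gamma) : R :=
  \sum_(s <- S) (h (s, x) - h (s, s^-1 * x)%g).

Lemma div_continuous x : continuous (divergence^~ x).
Proof.
apply: sum_continuous => s h; apply: continuousB.
- exact: (@proj_continuous _ (fun _ : Gamma * Gamma => R : topologicalType) (s, x)).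
- exact: (@proj_continuous _ (fun _ : Gamma * Gamma => R : topologicalType) (s, s^-1 * x)%g).
Qed.

Definition unit_flows : set flow := [set h | forall e, `|h e| <= 1].

Lemma unit_flows_compact : compact unit_flows.
Proof.
have := @tychonoff _ (fun _ : Gamma * Gamma => R : topologicalType)
  (fun=> `[-1, 1]%classic) (fun=> @segment_compact R (-1) 1).
congr compact; apply/seteqP; split => h /= Hh e; have := Hh e;
  by rewrite /= in_itv /= ler_norml.
Qed.

Section FinitePart.
Variables (eps : R) (A : seq Gamma).
Hypothesis eps_gt0 : 0 < eps.
Hypothesis uA : uniq A.
Hypothesis nF : forall F : seq Gamma, uniq F ->
  eps * (size F)%:R <= \sum_(s <- S) (count (fun h => (s * h)%g \notin F) F)%:R.

(** Every edge from x to s x that meets [A] starts in [B], so sums over [B] see the whole gradient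
    of a function supported on [A]. *)
Let B := undup (A ++ [seq (s^-1 * h)%g | s <- S, h <- A]).

Lemma sub_AB : {subset A <= B}.
Proof. by move=> x xA; rewrite mem_undup mem_cat xA. Qed.

Lemma sub_SAB s x : s \in S -> x \in A -> (s^-1 * x)%g \in B.
Proof.
move=> sS xA; rewrite mem_undup mem_cat; apply/orP; right.
by apply/allpairsP; exists (s, x).
Qed.

(** Layer cake for the edges from x to s x with x in [B]. The edges leaving a set are among those it
    cuts, so [nF] gives the hypothesis on level sets. *)
Lemma sum_gradient (w : Gamma -> R) :
    (forall x, 0 <= w x) -> (forall x, x \notin A -> w x = 0) ->
  eps * (\sum_(x <- A) w x) <= \sum_(s <- S) \sum_(x <- B) `|w x - w (s * x)%g|.
Proof.
move=> w0 wA.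
pose es := [seq (s, h) | s <- S, h <- B].
pose a (e : Gamma * Gamma) := e.2; pose b (e : Gamma * Gamma) := (e.1 * e.2)%g.
have := @level_set_cut R Gamma (Gamma * Gamma)%type a b es A uA eps w _ w0 wA.
rewrite /es big_allpairs_dep /=; apply=> F uF FA.
apply: le_trans (nF uF) _; rewrite -natr_sum ler_nat /cut_size /es.
rewrite -sumn_count sumnE big_map big_allpairs_dep /=.
rewrite leq_sum // => s _.
have -> : (\sum_(x <- B) ((x \in F) != (b (s, x) \in F)))%N =
    count (fun x => (x \in F) != ((s * x)%g \in F)) B.
  by rewrite -sumn_count sumnE big_map.
rewrite -!size_filter; apply: uniq_leq_size; first exact: filter_uniq.
move=> x; rewrite !mem_filter => /andP[sxF xF].
by rewrite xF sub_AB ?FA // andbT; case: (_ \in F) sxF.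
Qed.

(** Summation by parts: the inflow term is reindexed by y = s^-1 x, and no boundary term appears
    because [w] vanishes off [A]. *)
Lemma sum_by_parts (w : Gamma -> R) (h : flow) :
    (forall x, x \notin A -> w x = 0) ->
  \sum_(x <- A) w x * divergence h x =
    \sum_(s <- S) \sum_(x <- B) h (s, x) * (w x - w (s * x)%g).
Proof.
move=> wA.
under eq_bigr => x _ do rewrite /divergence mulr_sumr.
rewrite exchange_big /= big_seq [RHS]big_seq; apply: eq_bigr => s sS.
under eq_bigr => x _ do rewrite mulrBr.
under [RHS]eq_bigr => x _ do rewrite mulrBr.
rewrite !sumrB; congr (_ - _).
  rewrite (sum_subset uA (undup_uniq _) sub_AB); last first.
    by move=> x /wA ->; rewrite mul0r.
  by apply: eq_bigr => x _; rewrite mulrC.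
have -> : \sum_(x <- A) w x * h (s, s^-1 * x)%g =
    \sum_(y <- [seq (s^-1 * x)%g | x <- A]) h (s, y) * w (s * y)%g.
  by rewrite big_map; apply: eq_bigr => x _; rewrite mulVKg mulrC.
apply: sum_subset; [|exact: undup_uniq| |].
- by rewrite map_inj_uniq // => x y /(can_inj (mulKg _)).
- by move=> _ /mapP[x xA ->]; exact: sub_SAB.
- move=> y yA; rewrite wA ?mulr0 //; apply: contra yA => syA.
  by apply/mapP; exists (s * y)%g => //; rewrite mulKg.
Qed.

(* Minimise the sum over A of the squares of w x := posp (divergence h x + eps).
   Comparing the minimiser with the flow - sg (w x - w (s x)) gives
   sum w * divergence h <= - eps * sum w by the layer cake inequality, whereas
   divergence h > - eps wherever w is nonzero; so w = 0. *)
Lemma finite_flow : exists2 h : flow, unit_flows h &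
  forall x, x \in A -> divergence h x <= - eps.
Proof.
pose J (h : flow) := \sum_(x <- A) posp (divergence h x + eps) ^+ 2.
have cJ : continuous J.
  apply: sum_continuous => x; apply: sqr_continuous; apply: posp_continuous => h.
  by apply: continuousD; [exact: div_continuous|exact: cst_continuous].
have [|h /set_mem uh min_h] := compact_EVT_min _ unit_flows_compact
  (continuous_subspaceT cJ).
  by exists (fun=> 0) => e; rewrite normr0.
exists h => //.
pose w x := if x \in A then posp (divergence h x + eps) else 0.
have w0 x : 0 <= w x by rewrite /w; case: ifP => //; rewrite le_max lexx orbT.
have wA x : x \notin A -> w x = 0 by rewrite /w => /negbTE ->.
pose k : flow := fun e => - Num.sg (w e.2 - w (e.1 * e.2)%g).
have uk : unit_flows k.
  by move=> e; rewrite normrN normr_sg; case: (_ != _).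
(* Moving from [h] by a fraction [t] towards [k] stays among the unit flows and changes [J] by at
   most 2 t q + t^2 Q. *)
pose d x := divergence k x - divergence h x.
pose q := \sum_(x <- A) w x * d x.
pose Q := \sum_(x <- A) d x ^+ 2.
have Q0 : 0 <= Q by apply: sumr_ge0 => x _; exact: sqr_ge0.
have var t : 0 <= t -> t <= 1 -> 0 <= 2 * t * q + t ^+ 2 * Q.
  move=> t0 t1.
  pose ht : flow := fun e => h e + t * (k e - h e).
  have uht : unit_flows ht.
    move=> e; have -> : ht e = (1 - t) * h e + t * k e by rewrite /ht; ring.
    apply: le_trans (ler_normD _ _) _; rewrite !normrM (ger0_norm t0).
    rewrite ger0_norm ?subr_ge0 //.
    have := ler_wpM2l t0 (uk e); have t1' : 0 <= 1 - t by rewrite subr_ge0.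
    have := ler_wpM2l t1' (uh e); lra.
  have dht x : divergence ht x = divergence h x + t * d x.
    rewrite /d /divergence -sumrB mulr_sumr -big_split /=.
    by apply: eq_bigr => s _; rewrite /ht; ring.
  have := min_h ht (mem_set uht).
  rewrite -subr_ge0 /J -sumrB => /le_trans; apply.
  rewrite /q /Q !mulr_sumr -big_split /= big_seq [leRHS]big_seq.
  apply: ler_sum => x xA; rewrite dht lerBlDl.
  have := posp_sqr_le (divergence h x + eps) (t * d x).
  rewrite /w xA addrAC => /le_trans; apply; rewrite -addrA lerD2l.
  by rewrite le_eqVlt; apply/orP; left; apply/eqP; ring.
have q_ge0 : 0 <= q.
  rewrite leNgt; apply/negP => q0.
  (* This [t] makes 2 q + t Q equal to q (1 + t), which is negative. Dividing by Q - q instead of Q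
     keeps [t] at most 1 and covers Q = 0. *)
  pose t := - q / (Q - q).
  have Qq : 0 < Q - q by lra.
  have t0 : 0 < t by rewrite divr_gt0 // oppr_gt0.
  have t1 : t <= 1 by rewrite ler_pdivrMr // mul1r; lra.
  have := var t (ltW t0) t1.
  have -> : 2 * t * q + t ^+ 2 * Q = t * (2 * q + t * Q) by ring.
  rewrite pmulr_rge0 // leNgt => /negP; apply.
  have : t * (Q - q) = - q by rewrite /t divfK // gt_eqF.
  have := mulr_gt0 t0 (_ : 0 < - q); rewrite oppr_gt0 => /(_ q0); nra.
(* Where [w] is nonzero on [A] it equals the divergence of [h] plus eps. Hence the sum of squares is
   the sum of w times that divergence, plus eps times the sum of w, which is at most - q by [kw]. *)
have w_sum : \sum_(x <- A) w x ^+ 2 <= 0.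
  have kw : \sum_(x <- A) w x * divergence k x <= - (eps * \sum_(x <- A) w x).
    rewrite sum_by_parts // lerNr -sumrN.
    apply: le_trans (sum_gradient w0 wA) _; apply: ler_sum => s _.
    rewrite -sumrN; apply: ler_sum => x _ /=.
    by rewrite mulNr opprK -normrEsg.
  have : q = \sum_(x <- A) w x * divergence k x - \sum_(x <- A) w x * divergence h x.
    by rewrite /q -sumrB; apply: eq_bigr => x _; rewrite /d mulrBr.
  have -> : \sum_(x <- A) w x * divergence h x =
      \sum_(x <- A) w x ^+ 2 - eps * \sum_(x <- A) w x.
    rewrite mulr_sumr -sumrB big_seq [RHS]big_seq; apply: eq_bigr => x xA.
    rewrite /w xA /posp; case: leP => _; ring.
  lra.
move=> x xA; have /eqP : \sum_(x <- A) w x ^+ 2 = 0.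
  by apply/eqP; rewrite eq_le w_sum sumr_ge0 // => y _; exact: sqr_ge0.
rewrite psumr_eq0 => [/allP /(_ x xA)|y _]; last exact: sqr_ge0.
rewrite sqrf_eq0 /w xA /posp => /eqP dx.
have : divergence h x + eps <= 0 by rewrite -dx le_max lexx.
lra.
Qed.

End FinitePart.

(** Compactness: the closed conditions at single vertices have the finite intersection property by
    [finite_flow], and a cluster point satisfies them all. *)
Lemma global_flow (eps : R) : 0 < eps ->
    (forall F : seq Gamma, uniq F -> eps * (size F)%:R <=
       \sum_(s <- S) (count (fun h => (s * h)%g \notin F) F)%:R) ->
  exists2 h : flow, unit_flows h & forall x, divergence h x <= - eps.
Proof.
move=> eps_gt0 nF.
pose D (x : Gamma) : set flow := unit_flows `&` [set h | divergence h x <= - eps].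
have finD : finI setT D.
  move=> A _; have [h uh Hh] := finite_flow (fset_uniq A) nF.
  by exists h => x /= xA; split=> //; exact: Hh.
have [|h [uh clh]] := unit_flows_compact (finI_filter finD).
  by exists (D 1%g) => [|? []//]; exact: finI_from1.
exists h => // x.
have : closed [set h : flow | divergence h x <= - eps].
  apply: (@closed_comp _ _ (divergence^~ x) [set u | u <= - eps]); last exact: closed_le.
  by move=> k _; exact: div_continuous.
apply=> B hB; apply: clh => //; exists (D x); first exact: finI_from1.
by move=> k [].
Qed.

(* An invariant mean kills every divergence, so none can be <= - eps everywhere. *)
Lemma amenable_folner : amenable Gamma R -> folner.
Proof.
case=> m [mlin mpos m1 minv]; apply: contrapT => nfol.
have [eps eps_gt0 nF] : exists2 eps : R, 0 < eps & forall F : seq Gamma, uniq F ->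
    eps * (size F)%:R <= \sum_(s <- S) (count (fun h => (s * h)%g \notin F) F)%:R.
  apply: contrapT => nE; apply: nfol => eps eps_gt0.
  apply: contrapT => nF; apply: nE; exists eps => // F uF.
  have [->|F0] := eqVneq F [::]; first by rewrite mulr0 sumr_ge0.
  rewrite leNgt; apply/negP => small; apply: nF; exists F; split=> // s sS.
  apply: ltW; apply: le_lt_trans small.
  by rewrite (big_rem s sS) /= lerDl sumr_ge0.
have [h uh div_h] := global_flow eps_gt0 nF.
have bdd s : bounded_fun (fun x => h (s, x)) by apply/bounded_fun_leP; exists 1 => x; exact: uh.
have bddV s : bounded_fun (fun x => h (s, s^-1 * x)%g).
  by apply/bounded_fun_leP; exists 1 => x; exact: uh.
have bdd_cst (c : R) : bounded_fun (fun _ : Gamma => c).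
  by apply/bounded_fun_leP; exists `|c|.
have m0 : m (fun=> 0) = 0.
  have := mlin (-1) _ _ (bdd_cst 0) (bdd_cst 0).
  by under eq_fun do rewrite mulr0 addr0; rewrite mulN1r addNr.
have bdd_lin (a : R) (f g : Gamma -> R) : bounded_fun f -> bounded_fun g ->
    bounded_fun (fun x : Gamma => a * f x + g x).
  move=> /bounded_fun_leP[M HM] /bounded_fun_leP[N HN]; apply/bounded_fun_leP.
  exists (`|a| * M + N) => x; apply: le_trans (ler_normD _ _) _.
  by rewrite lerD // normrM ler_wpM2l.
(* Boundedness is carried through the induction together with the vanishing mean, because [mlin]
   applies to bounded functions only. *)
have [bdd_div m_div] : bounded_fun (divergence h) /\ m (divergence h) = 0.
  rewrite /divergence; elim: (enum_fset S) => [|s r [bddr mr]].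
    suff -> : (fun x => \sum_(t <- [::]) (h (t, x) - h (t, t^-1 * x)%g)) = fun=> 0 by [].
    by apply/funext => x; rewrite big_nil.
  have -> : (fun x => \sum_(t <- s :: r) (h (t, x) - h (t, t^-1 * x)%g)) =
     fun x => 1 * h (s, x) + (-1 * h (s, s^-1 * x)%g +
       \sum_(t <- r) (h (t, x) - h (t, t^-1 * x)%g)).
    by apply/funext => x; rewrite big_cons; ring.
  split; first by do 2 apply: (bdd_lin) => //.
  rewrite !mlin //; last exact: bdd_lin.
  by rewrite mr (minv s (fun x => h (s, x))) //; ring.
(* This nonnegative function has mean - eps; it is written in the shape that [mlin] unfolds. *)
have : 0 <= m (fun x => -1 * divergence h x + (- eps * 1 + 0)).
  apply: mpos; first by apply: bdd_lin.
  by move=> x; have := div_h x; lra.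
rewrite !mlin // m_div m1 m0; lra.
Qed.

End Folner.

(** * From Folner sets to an invariant mean *)

Section FolnerAmenable.
Variables (R : realType) (Gamma : groupType) (S : {fset Gamma}).

Definition defect (F : seq Gamma) (g : Gamma) : nat :=
  count (fun h => (g * h)%g \notin F) F.

(** If g k h is outside [F], then either k h is outside already, or k h is a point of [F] that g
    moves out. *)
Lemma defectM F g k : uniq F -> (defect F (g * k)%g <= defect F g + defect F k)%N.
Proof.
move=> uF; rewrite /defect addnC.
have -> : count (fun h => (g * h)%g \notin F) F =
    size [seq (k^-1 * h)%g | h <- F & (g * h)%g \notin F] by rewrite size_map size_filter.
rewrite -!size_filter -size_cat; apply: uniq_leq_size; first exact: filter_uniq.
move=> h; rewrite mem_filter mem_cat => /andP[gkh hF].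
have [khF|khF] := boolP ((k * h)%g \in F); last by rewrite mem_filter khF hF.
apply/orP; right; apply/mapP; exists (k * h)%g; rewrite ?mulKg //.
by rewrite mem_filter khF mulgA gkh.
Qed.

(** Multiplication by g maps the points that stay in [F] under g bijectively onto those that stay
    under g^-1. *)
Lemma defectV F g : uniq F -> defect F g^-1%g = defect F g.
Proof.
move=> uF.
have aux k : (count (fun h => (k^-1 * h)%g \in F) F <= count (fun h => (k * h)%g \in F) F)%N.
  rewrite -!size_filter -(size_map (fun h => (k^-1 * h)%g)).
  apply: uniq_leq_size.
    by rewrite map_inj_uniq ?filter_uniq // => x y /mulgI.
  move=> _ /mapP[h + ->]; rewrite !mem_filter mulVKg => /andP[-> ->] //.
have eq_in : count (fun h => (g^-1 * h)%g \in F) F = count (fun h => (g * h)%g \in F) F.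
  by apply/eqP; rewrite eqn_leq aux -{1}(invgK g) aux.
apply/eqP; rewrite -(eqn_add2l (count (fun h => (g * h)%g \in F) F)).
by rewrite -{1}eq_in /defect !count_predC.
Qed.

Definition average (F : seq Gamma) (f : Gamma -> R) : R :=
  (\sum_(h <- F) f h) / (size F)%:R.

(** After reindexing, the terms with g^-1 h in [F] cancel those with g h in [F]. Two sums of
    [defect F g] terms remain, one of them by [defectV]. *)
Lemma average_shift F (f : Gamma -> R) (M : R) g : uniq F ->
    (forall x, `|f x| <= M) ->
  `|average F (fun x => f (g^-1 * x)%g) - average F f| <=
    2 * M * ((defect F g)%:R / (size F)%:R).
Proof.
move=> uF fM.
have M0 : 0 <= M by apply: le_trans (fM 1%g).
have bnd (p : pred Gamma) (k : Gamma -> Gamma) :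
    `|\sum_(h <- F | p h) f (k h)| <= M * (count p F)%:R.
  apply: le_trans (ler_norm_sum _ _ _) _.
  rewrite -sum1_count natr_sum mulr_sumr; apply: ler_sum => h _.
  by rewrite mulr1.
rewrite /average -mulrBl normrM mulrA (@ger0_norm _ (size F)%:R^-1) ?invr_ge0 //.
rewrite ler_wpM2r ?invr_ge0 //.
rewrite (bigID (fun h => (g^-1 * h)%g \in F)) /= [X in _ - X](bigID (fun h => (g * h)%g \in F)) /=.
have -> : \sum_(h <- F | (g^-1 * h)%g \in F) f (g^-1 * h)%g =
          \sum_(h <- F | (g * h)%g \in F) f h.
  rewrite -[LHS]big_filter -[RHS]big_filter.
  rewrite -(big_map (fun h => (g^-1 * h)%g) xpredT f).
  apply/perm_big/uniq_perm; rewrite ?filter_uniq //.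
    by rewrite map_inj_uniq ?filter_uniq // => x y /mulgI.
  move=> h; rewrite mem_filter; apply/mapP/andP => [[x + ->]|[gh hF]].
    by rewrite mem_filter mulVKg => /andP[-> ->].
  by exists (g * h)%g; rewrite ?mem_filter mulKg ?hF ?gh.
rewrite opprD addrACA subrr add0r.
apply: le_trans (ler_normB _ _) _.
have := bnd (fun h => (g * h)%g \notin F) id.
have := bnd (fun h => (g^-1 * h)%g \notin F) (fun h => g^-1 * h)%g.
rewrite -[count _ _]/(defect F g^-1%g) defectV // -[count _ F]/(defect F g).
move=> /lerD /[apply] /le_trans; apply; lra.
Qed.

(** Compactness gives a cluster point, and a cluster point of an ultrafilter is a limit. *)
Lemma ultra_cvg (U : set_system nat) (a : nat -> R) (M : R) : UltraFilter U ->
  (forall n, `|a n| <= M) -> cvg (a @ U).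
Proof.
move=> UU aM.
have PU : ProperFilter U by exact: ultra_proper.
have aI : U (a @^-1` `[- M, M]%classic).
  by apply: filterE => n; rewrite /= in_itv /= -ler_norml.
have [p [_ clp]] := @segment_compact R (- M) M (a @ U) _ aI.
apply/cvg_ex; exists p => B Bp.
have [UB|UB] := in_ultra_setVsetC (a @^-1` B) UU; first exact: UB.
by have [x []] := clp (~` B) B UB Bp.
Qed.

Hypothesis S_gen : generates S.

(** The mean is the limit of averages over ever better Folner sets, along an ultrafilter finer than
    [\oo] so that it exists for all bounded functions. *)
Lemma folner_amenable : folner R S -> amenable Gamma R.
Proof.
move=> fol.
have /choice[F HF] : forall k : nat, exists F : seq Gamma,
    [/\ uniq F, F != [::] & forall s, s \in S -> (defect F s)%:R <= k.+1%:R^-1 * (size F)%:R :> R].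
  by move=> k; apply: fol; rewrite invr_gt0.
have uF k : uniq (F k) by case: (HF k).
have F0 k : 0 < (size (F k))%:R :> R.
  by case: (HF k) => _ + _; rewrite ltr0n; case: (F k).
have def_cvg g : ((defect (F k) g)%:R / (size (F k))%:R : R) @[k --> \oo] --> 0.
  (* The elements of vanishing relative defect form a subgroup by [defectM] and [defectV], and it
     contains [S]. *)
  pose H : {pred Gamma} := fun g =>
    `[< ((defect (F k) g)%:R / (size (F k))%:R : R) @[k --> \oo] --> 0 >].
  suff Hgrp : group_closed H.
    apply/asboolP; apply: (S_gen Hgrp) => s sS; apply/asboolP.
    apply: (@squeeze_cvgr _ _ _ _ (fun=> 0) (fun k => k.+1%:R^-1)).
    - near=> k; rewrite divr_ge0 //= ler_pdivrMr //.
      by case: (HF k) => _ _; exact.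
    - exact: cvg_cst.
    - exact: cvg_harmonic.
  have sq (d : nat -> nat) (e : nat -> R) : (forall k, (d k)%:R <= e k) ->
      e k / (size (F k))%:R @[k --> \oo] --> 0 ->
      ((d k)%:R / (size (F k))%:R : R) @[k --> \oo] --> 0.
    move=> de e0; apply: (@squeeze_cvgr _ _ _ _ (fun=> 0) (fun k => e k / (size (F k))%:R)).
    - near=> k; rewrite divr_ge0 //= ler_wpM2r // invr_ge0 //.
    - exact: cvg_cst.
    - exact: e0.
  split.
    apply/asboolP; apply: (sq (fun k => defect (F k) 1%g) (fun=> 0)).
      move=> k; rewrite lern0 /defect -leqn0 leqNgt -has_count.
      by apply/hasPn => h hF; rewrite mul1g negbK.
    by under eq_fun do rewrite mul0r; exact: cvg_cst.
  move=> u v /asboolP uH /asboolP vH; apply/asboolP.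
  apply: (sq (fun k => defect (F k) (u / v)%g)
             (fun k => (defect (F k) u)%:R + (defect (F k) v)%:R)).
    by move=> k; rewrite -natrD ler_nat -(defectV v (uF k)) defectM.
  by under eq_fun do rewrite mulrDl; have H0 := cvgD uH vH; rewrite addr0 in H0; exact: H0.
have [U [UU Uoo]] := ultraFilterLemma (_ : ProperFilter \oo).
have PU : ProperFilter U by exact: ultra_proper.
pose av f k := average (F k) f.
have avM f (M : R) : (forall x, `|f x| <= M) -> forall k, `|av f k| <= M.
  move=> fM k; rewrite /av /average normrM (@ger0_norm _ (size (F k))%:R^-1) ?invr_ge0 //.
  rewrite ler_pdivrMr //; apply: le_trans (ler_norm_sum _ _ _) _.
  rewrite -sum1_size natr_sum mulr_sumr; apply: ler_sum => h _; by rewrite mulr1.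
have av_cvg f : bounded_fun f -> cvg (av f @ U).
  by move=> /bounded_fun_leP[M /avM]; exact: ultra_cvg.
exists (fun f => lim (av f @ U)); split.
- move=> a f g bf bg; apply: cvg_lim => //.
  have -> : av (fun x => a * f x + g x) = fun k => a * av f k + av g k.
    apply/funext => k; rewrite /av /average big_split /= -mulr_sumr mulrDl.
    by rewrite mulrA.
  by apply: cvgD; [apply: cvgM; [exact: cvg_cst|exact: av_cvg]|exact: av_cvg].
- move=> f bf f0; apply: limr_ge; first exact: av_cvg.
  by apply: filterE => k; rewrite divr_ge0 // sumr_ge0.
- apply: cvg_lim => //.
  have -> : av (fun=> 1) = fun=> 1.
    by apply/funext => k; rewrite /av /average big_const_seq count_predT iter_addr_0 divff // gt_eqF.
  exact: cvg_cst.
- move=> g f bf; apply: cvg_lim => //.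
  have -> : av (fun x => f (g^-1 * x)%g) =
      fun k => (av (fun x => f (g^-1 * x)%g) k - av f k) + av f k.
    by apply/funext => k; rewrite subrK.
  suff d0 : (av (fun x => f (g^-1 * x)%g) k - av f k) @[k --> U] --> 0.
    by have H := cvgD d0 (av_cvg f bf); rewrite add0r in H; exact: H.
  apply: (@cvg_trans _ ((av (fun x => f (g^-1 * x)%g) k - av f k) @[k --> \oo])).
    by move=> B; exact: Uoo.
  have [M fM] := (bounded_fun_leP f).1 bf.
  apply: norm_cvg0; apply: (@squeeze_cvgr _ _ _ _ (fun=> 0)
     (fun k => 2 * M * ((defect (F k) g)%:R / (size (F k))%:R))).
  + by near=> k; rewrite normr_ge0 /=; exact: average_shift.
  + exact: cvg_cst.
  + by have H := cvgM (@cvg_cst _ (2 * M : R) _ \oo _) (def_cvg g); rewrite mulr0 in H; exact: H.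
Unshelve. all: by end_near. Qed.

End FolnerAmenable.

(** * The l1 norm of finitely supported functions *)

Section Norm1.
Variables (R : realType) (T : choiceType).

Lemma norm1_fin (I : finType) (P : pred I) (i : I -> T) (u : T -> R) :
    {in P &, injective i} -> (forall t, u t != 0 -> exists2 j, P j & t = i j) ->
  norm1 u = (\sum_(j | P j) `|u (i j)|)%:E.
Proof.
move=> inj_i supp_u.
have -> : norm1 u = \esum_(t in i @` [set j | P j]) `|u t|%:E.
  rewrite /norm1 [RHS]esum_mkcond; apply: eq_esum => t _.
  case: ifPn => // /negP it; apply/eqP; rewrite eqe normr_eq0; apply: contra_notT it.
  by move=> /supp_u[j Pj ->]; rewrite inE; exists j.
rewrite esum_image; last by move=> x y; rewrite !inE; exact: inj_i.
rewrite esum_fset; [|exact: finite_finset|by move=> t _; rewrite lee_fin].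
by rewrite -sumEFin [RHS]bigfs ?index_enum_uniq // => j _; rewrite mem_index_enum.
Qed.
End Norm1.

(** * Balls and walks *)

Section Balls.
Variables (L : Type) (G : lgraph L).
Implicit Types (x y z : vertex G) (r k : nat).

Lemma gball0 x y : gball 0 x y <-> x = y.
Proof.
split=> [[p [_ <-]]|->]; last exact: gball_center.
by rewrite leqn0 size_eq0 => /eqP ->.
Qed.

Lemma gballS r x y :
  gball r.+1 x y <-> gball r x y \/ exists2 z, gball r x z & adj z y.
Proof.
split=> [[p [xp <-{y} sp]]|[[p [xp <- sp]]|[z [p [xp <- sp]] zy]]].
- case: (leqP (size p) r) => [spr|rsp]; first by left; exists p.
  right; case/lastP: p => [//|p z] in xp sp rsp *.
  move: xp; rewrite rcons_path last_rcons => /andP[xp pz].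
  by exists (last x p) => //; exists p; split=> //; rewrite size_rcons in sp.
- by exists p; split=> //; exact: leqW.
- by exists (rcons p y); rewrite rcons_path xp last_rcons size_rcons.
Qed.

Lemma gball_le r k x y : (r <= k)%N -> gball r x y -> gball k x y.
Proof. by move=> rk [p [xp xy pr]]; exists p; split=> //; exact: leq_trans rk. Qed.

Lemma adjC x y : adj x y = adj y x.
Proof. by apply/asboolP/asboolP => -[e He]; exists e; case: He; auto. Qed.

Lemma adj_edge (e : edge G) : adj (src e) (tgt e).
Proof. by apply/asboolP; exists e; left. Qed.

Lemma gballC r x y : gball r x y -> gball r y x.
Proof.
case=> p [xp xy pr]; exists (rev (belast x p)); split.
- by rewrite -xy rev_path (eq_path (e' := adj (G := G))) // => u v; rewrite adjC.
- by case: p xp xy pr => //= a p _ _ _; rewrite rev_cons last_rcons.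
- by rewrite size_rev size_belast.
Qed.

End Balls.

(** * Charts: Cayley balls inside a finite graph *)

Section Charts.
Variables (Gamma : groupType) (S : {fset Gamma}).
Local Notation cball r := (@gball S (Cay S) r 1%g).

Lemma cballS_mul r (h : Gamma) (s : S) : cball r h -> cball r.+1 (h * val s)%g.
Proof.
move=> rh; apply/gballS; right; exists h => //.
by apply/asboolP; exists (h, s); left.
Qed.

Lemma cballS_mulV r (h : Gamma) (s : S) : cball r h -> cball r.+1 (h * (val s)^-1)%g.
Proof.
move=> rh; apply/gballS; right; exists h => //.
by apply/asboolP; exists ((h * (val s)^-1)%g, s); right; rewrite /= mulgVK.
Qed.

(** Adjacency forgets orientation, so the last step of a walk multiplies by a generator or an
    inverse. The predicate sees the radius because later uses carry a bound on it. *)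
Lemma cball_ind (P : nat -> Gamma -> Prop) :
    P 0%N 1%g -> (forall r h, P r h -> P r.+1 h) ->
    (forall r h (s : S), cball r h -> P r h -> P r.+1 (h * val s)%g) ->
    (forall r h (s : S), cball r h -> P r h -> P r.+1 (h * (val s)^-1)%g) ->
  forall r h, cball r h -> P r h.
Proof.
move=> P0 Pw PM PV; elim=> [|r IH] h; first by move=> /gball0 <-.
move=> /gballS[/IH|[h' rh' /asboolP[[k s] /= [[-> <-]|[<- kh]]]]]; first exact: Pw.
  by apply: PM; last exact: IH.
have -> : k = (h' * (val s)^-1)%g by rewrite -kh mulgK.
by apply: PV; last exact: IH.
Qed.

Variable G : flgraph S.

(** Edge lifting alone is assumed, not a whole chart, because the result is needed while a chart is
    being constructed. *)
Lemma lift_ball r (phi : Gamma -> fvertex G) k h :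
    (forall h (s : S), cball r h -> cball r (h * val s)%g ->
      exists e : fedge G, [/\ fsrc e = phi h, ftgt e = phi (h * val s)%g & flab e = s]) ->
  cball k h -> (k <= r)%N -> @gball S G k (phi 1%g) (phi h).
Proof.
move=> lift; move: k h; apply: cball_ind.
- by move=> _; exact: gball_center.
- by move=> k h IH /ltnW kr; apply/gballS; left; exact: IH.
- move=> k h s Hh IH kr; apply/gballS; right; exists (phi h); first exact/IH/ltnW.
  have [||e [<- <- _]] := lift h s; last exact: (@adj_edge _ G e).
    by apply: gball_le Hh; exact: ltnW.
  by apply: (gball_le kr); exact: cballS_mul.
- move=> k h s Hh IH kr; apply/gballS; right; exists (phi h); first exact/IH/ltnW.
  have [||e [<- ]] := lift (h * (val s)^-1)%g s.
  + by apply: (gball_le kr); exact: cballS_mulV.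
  + by rewrite mulgVK; apply: gball_le Hh; exact: ltnW.
  + by rewrite mulgVK adjC => <- _; exact: (@adj_edge _ G e).
Qed.

(* phi identifies the r-ball of the Cayley graph at 1 with the r-ball at x; its
   values outside that ball are irrelevant. *)
Record chart r (x : fvertex G) (phi : Gamma -> fvertex G) : Prop := Chart {
  chart1 : phi 1%g = x;
  chart_inj : forall g h, cball r g -> cball r h -> phi g = phi h -> g = h;
  chart_lift : forall h (s : S), cball r h -> cball r (h * val s)%g ->
    exists e : fedge G, [/\ fsrc e = phi h, ftgt e = phi (h * val s)%g & flab e = s];
  chart_tgt : forall k h (e : fedge G), (k < r)%N -> cball k h ->
    fsrc e = phi h -> ftgt e = phi (h * val (flab e))%g;
  chart_src : forall k h (e : fedge G), (k < r)%N -> cball k h ->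
    ftgt e = phi h -> fsrc e = phi (h * (val (flab e))^-1)%g }.

(** The chart is the inverse of the vertex isomorphism, made total; the edge isomorphism gives the
    lifting and the endpoint formulas. *)
Lemma gball_iso_chart r (x : fvertex G) :
  @gball_iso S r G x (Cay S) 1%g -> exists phi, chart r x phi.
Proof.
case=> f [g [[f' fK f'K] [g' gK g'K] fx fg]].
pose phi (h : Gamma) : fvertex G :=
  if pselect (cball r h) is left H then val (f' (exist _ h (mem_set H))) else x.
have phiE h (H : h \in (cball r : set Gamma)) : phi h = val (f' (exist _ h H)).
  rewrite /phi; case: pselect => [H'|/(_ (set_mem H))//].
  by congr (val (f' (exist _ _ _))); exact: bool_irrelevance.
have valK' (u : vertex (induced_subgraph (cball r : set (vertex (Cay S))))) H :
    exist _ (val u) H = u by exact: val_inj.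
have phiP h (H : cball r h) : @gball S G r x (phi h).
  by rewrite (phiE _ (mem_set H)); exact: set_mem (valP (f' _)).
have phi1 : phi 1%g = x.
  rewrite (phiE _ (mem_set (gball_center r (1%g : vertex (Cay S))))).
  by rewrite -[exist _ _ _]fx fK.
have lift h (s : S) : cball r h -> cball r (h * val s)%g ->
    exists e : fedge G, [/\ fsrc e = phi h, ftgt e = phi (h * val s)%g & flab e = s].
  move=> Hh Hs.
  have Ee : (edges_in (cball r : set (vertex (Cay S)))) (h, s) by split.
  pose e : edge (induced_subgraph (cball r : set (vertex (Cay S)))) :=
    exist _ (h, s) (mem_set Ee).
  have [se te le] := fg (g' e).
  exists (val (g' e)); split.
  - rewrite (phiE _ (mem_set Hh)) -[fsrc _]/(val (induced_src (g' e))).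
    congr val; rewrite -[LHS]fK -se g'K; congr f'.
    by apply: val_inj.
  - rewrite (phiE _ (mem_set Hs)) -[ftgt _]/(val (induced_tgt (g' e))).
    congr val; rewrite -[LHS]fK -te g'K; congr f'.
    by apply: val_inj.
  - by move: le; rewrite g'K.
have phi_ball k h : cball k h -> (k <= r)%N -> @gball S G k x (phi h).
  by rewrite -phi1; exact: lift_ball.
(* [g] carries an edge with both ends in the ball to a Cayley edge with the same label, which
   determines both ends. *)
have edge_eq (e : fedge G) : @gball S G r x (fsrc e) -> @gball S G r x (ftgt e) ->
    exists h : Gamma, [/\ cball r h, cball r (h * val (flab e))%g,
      phi h = fsrc e & phi (h * val (flab e))%g = ftgt e].
  move=> Hs Ht.
  have Ee : (edges_in (@gball S G r x : set (vertex G))) e by split.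
  pose e' : edge (induced_subgraph (@gball S G r x : set (vertex G))) :=
    exist _ e (mem_set Ee).
  have [se te le] := fg e'.
  have lg : (val (g e')).2 = flab e by exact: le.
  have sg : (val (g e')).1 = val (f (induced_src e')) by rewrite -se.
  have tg : ((val (g e')).1 * val (val (g e')).2)%g = val (f (induced_tgt e')).
    by rewrite -te.
  have [Hh Hhs] := set_mem (valP (g e')).
  exists (val (g e')).1; rewrite -lg; split=> //.
  - by rewrite sg (phiE _ (valP _)) valK' fK.
  - by rewrite tg (phiE _ (valP _)) valK' fK.
have phi_inj h1 h2 : cball r h1 -> cball r h2 -> phi h1 = phi h2 -> h1 = h2.
  move=> H1 H2; rewrite (phiE _ (mem_set H1)) (phiE _ (mem_set H2)).
  by move=> /val_inj /(can_inj f'K) [].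
exists phi; split=> //.
(* The strict bound on k keeps the far end of the edge inside the r-ball, as [edge_eq] requires. *)
- move=> k h e kr Hh se.
  have [||h' [H' _ ph' <-]] := edge_eq e.
  + by rewrite se; apply: (gball_le (ltnW kr)); exact: phi_ball _ _ Hh (ltnW kr).
  + apply: (gball_le kr); apply/gballS; right; exists (phi h).
      exact: phi_ball _ _ Hh (ltnW kr).
    by rewrite -se; exact: (@adj_edge _ G e).
  + suff -> : h = h' by [].
    apply: phi_inj => //; last by rewrite ph' -se.
    exact: gball_le (ltnW kr) Hh.
- move=> k h e kr Hh te.
  have [||h' [H' H's <- ph']] := edge_eq e.
  + apply: (gball_le kr); apply/gballS; right; exists (phi h).
      exact: phi_ball _ _ Hh (ltnW kr).
    by rewrite -te adjC; exact: (@adj_edge _ G e).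
  + by rewrite te; apply: (gball_le (ltnW kr)); exact: phi_ball _ _ Hh (ltnW kr).
  + suff -> : h = (h' * val (flab e))%g by rewrite mulgK.
    apply: phi_inj => //; last by rewrite ph' -te.
    exact: gball_le (ltnW kr) Hh.
Qed.
End Charts.

(** * Property A in terms of finite sums *)

Section FiniteA.
Variables (R : realType) (L : Type) (G : nat -> flgraph L).
Variable W : forall n, {set fvertex (G n)}.

Local Notation H n := (@induced_subgraph L (G n) [set x : fvertex (G n) | x \notin W n]).
Local Notation DU := (disjoint_union (fun n => H n)).

Definition walk_avoiding n : rel (fvertex (G n)) := fun x y =>
  [&& @adj L (G n) x y, x \notin W n & y \notin W n].

(** Edges of the disjoint union keep their tag, so a walk stays in its graph and projects to a walk
    off [W]. *)
Lemma gball_union r n (a : vertex (H n)) (t : vertex DU) :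
    gball r (existT _ n a : vertex DU) t ->
  exists b : vertex (H n), t = existT _ n b /\
    exists p, [/\ path (@walk_avoiding n) (val a) p, last (val a) p = val b & (size p <= r)%N].
Proof.
elim: r t => [|r IH] t.
  by move=> /gball0 <-; exists a; split=> //; exists [::].
move=> /gballS[/IH[b [-> [p [ap pb pr]]]]|[z /IH[b [-> [p [ap pb pr]]]]]].
  by exists b; split=> //; exists p; split=> //; exact: leqW.
have stepP (c : vertex (H n)) : @adj L (G n) (val b) (val c) ->
    exists p0, [/\ path (@walk_avoiding n) (val a) p0, last (val a) p0 = val c & (size p0 <= r.+1)%N].
  move=> bc; exists (rcons p (val c)); rewrite rcons_path ap last_rcons size_rcons pb; split=> //.
  by rewrite /walk_avoiding bc /=; apply/andP; split; [exact: (set_mem (valP b))|exact: (set_mem (valP c))].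
move=> /asboolP[[m e] /= [[]|[]]].
- move=> se <-; have mn : m = n by exact: (congr1 tag se).
  subst m; exists (induced_tgt e); split=> //; apply: stepP.
  have <- : induced_src e = b by apply/eqP; move/eqP: se; rewrite eq_Tagged.
  exact: (@adj_edge _ (G n) (val e)).
- move=> <- te; have mn : m = n by exact: (congr1 tag te).
  subst m; exists (induced_src e); split=> //; apply: stepP.
  have <- : induced_tgt e = b by apply/eqP; move/eqP: te; rewrite eq_Tagged.
  by rewrite adjC; exact: (@adj_edge _ (G n) (val e)).
Qed.

Lemma union_gball n (p : seq (fvertex (G n))) (a b : vertex (H n)) :
    path (@walk_avoiding n) (val a) p -> last (val a) p = val b ->
  gball (size p) (existT _ n a : vertex DU) (existT _ n b : vertex DU).
Proof.
elim/last_ind: p b => [|p z IH] b /=; first by move=> _ /val_inj ->; exact: gball_center.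
rewrite rcons_path last_rcons size_rcons => /andP[ap /and3P[lz lW zW]] zb.
pose c : vertex (H n) := exist _ (last (val a) p) (mem_set lW).
apply/gballS; right; exists (existT _ n c); first exact: IH.
move: lz => /asboolP[e He']; apply/asboolP.
have He : (fsrc e = last (val a) p /\ ftgt e = z) \/ (fsrc e = z /\ ftgt e = last (val a) p).
  exact: He'.
have Ee : edges_in ([set x : fvertex (G n) | x \notin W n] : set (vertex (G n))) e.
  by case: He => -[se te]; split=> /=; rewrite ?se ?te.
exists (existT _ n (exist _ e (mem_set Ee)) : edge DU).
case: He => -[se te]; [left|right]; split; congr existT; apply: val_inj => //=.
- by rewrite te.
- by rewrite se.
Qed.

Lemma norm1_union n (a : vertex (H n)) (u : vertex DU -> R) :
    (forall t, u t != 0 -> exists b : vertex (H n), t = existT _ n b) ->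
  norm1 u = (\sum_(y | y \notin W n) `|u (existT _ n (insubd a y))|)%:E.
Proof.
move=> supp_u.
have insK y : y \notin W n -> val (insubd a y) = y.
  by move=> yW; rewrite insubdK //; exact: mem_set.
apply: (@norm1_fin R (vertex DU) (fvertex (G n)) (fun y => y \notin W n)
  (fun y => existT _ n (insubd a y))).
  move=> x y xW yW /eqP; rewrite eq_Tagged /= => /eqP xy.
  by rewrite -(insK x xW) -(insK y yW) xy.
move=> t /supp_u[b ->]; exists (val b); first exact: (set_mem (valP b)).
by rewrite valKd.
Qed.

(** The share of property A that concerns one graph, with plain vertices in place of a tagged
    subtype. *)
Definition finite_property_A (eps : R) (r : nat) n (u : fvertex (G n) -> fvertex (G n) -> R) :=
  [/\ forall x, x \notin W n -> \sum_y `|u x y| = 1,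
      forall x y, x \notin W n -> u x y != 0 -> exists p,
        [/\ path (@walk_avoiding n) x p, last x p = y & (size p <= r)%N]
    & forall e : fedge (G n), fsrc e \notin W n -> ftgt e \notin W n ->
        \sum_y `|u (fsrc e) y - u (ftgt e) y| < eps].

Lemma walk_last n x (p : seq (fvertex (G n))) :
  x \notin W n -> path (@walk_avoiding n) x p -> last x p \notin W n.
Proof.
move=> xW; case/lastP: p => // p z; rewrite rcons_path last_rcons.
by case/andP => _ /and3P[].
Qed.

(** Neither edges nor balls join two graphs of the union, so property A splits into one condition
    per graph; only the radius has to be uniform. *)
Lemma property_A_finite : property_A R DU <->
  forall eps : R, 0 < eps -> exists r, forall n, exists u, @finite_property_A eps r n u.
Proof.
have sumW n (f : fvertex (G n) -> R) : (forall y, y \in W n -> f y = 0) ->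
    \sum_y `|f y| = \sum_(y | y \notin W n) `|f y|.
  move=> fW; rewrite (bigID (fun y => y \in W n)) /= big1 ?add0r // => y /fW ->.
  by rewrite normr0.
split=> [A eps /A[r [r0 [xi [xi1 xi_ball xi_eps]]]]|A eps /A[r Hr]].
  exists r => n.
  (* Extension of [xi] by zero to the deleted vertices. *)
  pose u (x y : fvertex (G n)) : R :=
    if (insub x : option (vertex (H n))) is Some a then
      if (insub y : option (vertex (H n))) is Some b then
        xi (existT _ n a) (existT _ n b) else 0 else 0.
  have insW y : y \in W n -> (insub y : option (vertex (H n))) = None.
    by move=> yW; rewrite insubN //; apply/negP => /set_mem /=; rewrite yW.
  have uW x y : y \in W n -> u x y = 0.
    by move=> yW; rewrite /u (insW y yW); case: insub.
  have insS (a : vertex (H n)) y : y \notin W n ->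
      (insub y : option (vertex (H n))) = Some (insubd a y).
    by move=> yW; rewrite /insubd; case: insubP => //= /negP[]; exact: mem_set.
  have xi_supp (a : vertex (H n)) t : xi (existT _ n a) t != 0 ->
      exists b : vertex (H n), t = existT _ n b.
    by move=> /xi_ball /gball_union[b [-> _]]; exists b.
  exists u; split.
  - move=> x xW; pose a : vertex (H n) := exist _ x (mem_set xW).
    rewrite sumW; last by move=> y; exact: uW.
    apply: EFin_inj; rewrite -(xi1 (existT _ n a)) (norm1_union a); last exact: xi_supp.
    congr EFin; apply: eq_bigr => y yW.
    by rewrite /u (insS a y yW) (valK a : insub x = Some a).
  - move=> x y xW; rewrite /u; case: insubP => [a _ ax|]; last by rewrite eqxx.
    case: insubP => [b _ by_|]; last by rewrite eqxx.
    move=> /xi_ball /gball_union[b' [/eqP]]; rewrite eq_Tagged /= => /eqP <-.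
    by rewrite ax by_.
  - move=> e sW tW.
    have Ee : edges_in ([set x : fvertex (G n) | x \notin W n] : set (vertex (G n))) e by split.
    pose e' : edge (H n) := exist _ e (mem_set Ee).
    have := xi_eps (existT _ n e' : edge DU).
    rewrite (norm1_union (induced_src e')); last first.
      move=> t; have [->|/xi_supp //] := eqVneq (xi (src (existT _ n e' : edge DU)) t) 0.
      have [->|/xi_supp //] := eqVneq (xi (tgt (existT _ n e' : edge DU)) t) 0.
      by rewrite subrr eqxx.
    rewrite lte_fin; apply: le_lt_trans.
    rewrite sumW; last by move=> y yW; rewrite !uW ?subrr.
    apply: ler_sum => y yW.
    rewrite /u (insS (induced_src e') y yW).
    by rewrite (valK (induced_src e') : insub (fsrc e) = Some _)
               (valK (induced_tgt e') : insub (ftgt e) = Some _).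
(* The successor is taken because [property_A] asks for a positive radius. *)
exists r.+1; split=> //.
pose u n := projT1 (cid (Hr n)).
have uP n : finite_property_A eps r (u n) := projT2 (cid (Hr n)).
pose xi (s t : vertex DU) : R :=
  if tag t == tag s then u (tag s) (val (tagged s)) (val (tagged_as s t)) else 0.
have xiE n (a b : vertex (H n)) : xi (existT _ n a) (existT _ n b) = u n (val a) (val b).
  have E : tagged_as (existT _ n a : vertex DU) (existT _ n b : vertex DU) = b.
    exact: (@tagged_asE _ _ (existT _ n a : vertex DU) b).
  by rewrite /xi eqxx E.
have xi_supp n (a : vertex (H n)) t : xi (existT _ n a) t != 0 ->
    exists b : vertex (H n), t = existT _ n b.
  rewrite /xi; case: ifP => /= [/eqP tn _|]; last by rewrite eqxx.
  by case: t tn => m b /= mn; subst m; exists b.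
have aW n (a : vertex (H n)) : val a \notin W n by exact: (set_mem (valP a)).
have uW n x y : x \notin W n -> y \in W n -> u n x y = 0.
  move=> xW yW; apply/eqP; apply: contraTT yW => /(_ =P _) uxy.
  have [_ + _] := uP n => /(_ x y xW)[|p [xp <- _]]; first exact/eqP.
  exact: walk_last xW xp.
have insK n (a : vertex (H n)) y : y \notin W n -> val (insubd a y) = y.
  by move=> yW; rewrite insubdK //; exact: mem_set.
exists xi; split.
- move=> [n a]; rewrite (norm1_union a); last exact: xi_supp.
  have [u1 _ _] := uP n; rewrite -(u1 (val a) (aW n a)); congr EFin.
  rewrite sumW; last by move=> y; apply: uW; exact: aW.
  by apply: eq_bigr => y yW; rewrite xiE insK.
- move=> [n a] t xit; have [b tb] := xi_supp n a t xit; subst t.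
  move: xit; rewrite xiE; have [_ + _] := uP n => /(_ _ _ (aW n a)) /[apply] -[p [ap pb pr]].
  exact: gball_le (leqW pr) (union_gball ap pb).
- move=> [n e] /=.
  rewrite (norm1_union (induced_src e)); last first.
    move=> t; have [->|/xi_supp //] := eqVneq (xi (existT _ n (induced_src e)) t) 0.
    have [->|/xi_supp //] := eqVneq (xi (existT _ n (induced_tgt e)) t) 0.
    by rewrite subrr eqxx.
  rewrite lte_fin; have [_ _ /(_ (val e))] := uP n.
  move=> /(_ (aW n (induced_src e)) (aW n (induced_tgt e))); apply: le_lt_trans.
  rewrite [leRHS]sumW; last first.
    by move=> y yW; rewrite !uW ?subrr //; [exact: (aW n (induced_tgt e))|exact: (aW n (induced_src e))].
  by apply: ler_sum => y yW; rewrite !xiE insK.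
Qed.

End FiniteA.

(** * Counting in graphs of bounded degree *)

Lemma leq_card_bigcup (I T : finType) (P : pred I) (F : I -> {set T}) :
  (#|\bigcup_(i | P i) F i|%SET <= \sum_(i | P i) #|F i|)%N.
Proof.
elim/big_rec2: _ => [|i n A _ le_An]; first by rewrite cards0.
by apply: leq_trans (leq_card_setU _ _) _; rewrite leq_add2l.
Qed.

Section BoundedDegree.
Variables (L : Type) (G : flgraph L) (d : nat).
Hypothesis deg_d : forall x : fvertex G, (degree x <= d)%N.

(** Each vertex of a ball contributes itself and at most [d] neighbours to the next ball. *)
Lemma gball_card r (x : fvertex G) :
  (#|[set y : fvertex G | `[< @gball L G r x y >]]%SET| <= d.+1 ^ r)%N.
Proof.
elim: r => [|r IH].
  rewrite expn0 -(cards1 x); apply/subset_leq_card/fintype.subsetP => y.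
  by rewrite !inE => /(@gball0 _ G) ->.
set B := [set y | _]%SET in IH.
pose N (z : fvertex G) := [set @ftgt L G e | e in [set e | fsrc e == z]]%SET :|:
  [set @fsrc L G e | e in [set e | ftgt e == z]]%SET.
have cardN z : (#|N z| <= d)%N.
  apply: leq_trans (deg_d z); rewrite /degree; apply: leq_trans (leq_card_setU _ _) _.
  by rewrite leq_add // leq_imset_card.
apply: leq_trans (_ : #|B :|: \bigcup_(z in B) N z|%SET <= _)%N.
  apply/subset_leq_card/fintype.subsetP => y; rewrite !inE.
  move=> /(@gballS _ G)[xy|[z xz /asboolP[e ze]]]; apply/orP.
    by left; apply/asboolP.
  right; apply/finset.bigcupP; exists z; first by rewrite inE; apply/asboolP.
  rewrite inE; apply/orP; case: ze => -[se te]; [left|right];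
    apply/finset.imsetP; exists e; rewrite ?inE //; exact/eqP.
apply: leq_trans (leq_card_setU _ _) _.
rewrite expnSr mulnS leq_add //.
apply: leq_trans (leq_card_bigcup _ _) _.
apply: leq_trans (_ : \sum_(z in B) d <= _)%N; first by apply: leq_sum.
by rewrite sum_nat_const leq_mul2r IH orbT.
Qed.

Lemma incident_card (X : {set fvertex G}) :
  (#|[set e : fedge G | (fsrc e \in X) || (ftgt e \in X)]%SET| <= d * #|X|)%N.
Proof.
apply: leq_trans (_ : #|\bigcup_(x in X) ([set e | fsrc e == x] :|: [set e | ftgt e == x])|%SET <= _)%N.
  apply/subset_leq_card/fintype.subsetP => e; rewrite inE => /orP[] eX; apply/finset.bigcupP.
    by exists (fsrc e) => //; rewrite !inE eqxx.
  by exists (ftgt e) => //; rewrite !inE eqxx orbT.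
apply: leq_trans (leq_card_bigcup _ _) _.
apply: leq_trans (_ : \sum_(z in X) d <= _)%N; last by rewrite sum_nat_const mulnC.
apply: leq_sum => x _; apply: leq_trans (leq_card_setU _ _) _; exact: deg_d.
Qed.

End BoundedDegree.

(** * Greedy partition into small pieces with few edges between them *)

Section Greedy.
Variables (R : realType) (T E : finType) (a b : E -> T) (c : R) (K : nat).
Variable X : {set T}.
Hypothesis cut_small : forall H : {set T}, H \subset X -> H != finset.set0 ->
  exists F : {set T}, [/\ F \subset H, F != finset.set0, (#|F| <= K)%N
    & #|[set e | [&& a e \in H, b e \in H & (a e \in F) != (b e \in F)]]%SET|%:R
      <= c * #|F|%:R].

(** Pieces are split off one after the other, and each cut edge is charged to the first piece
    separating its ends. The pieces are the fibres of [p]. *)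
Lemma greedy_partition (H : {set T}) : H \subset X -> exists p : T -> T,
  [/\ forall x, x \in H -> p x \in H,
      forall y, (#|[set x in H | p x == y]%SET| <= K)%N
    & #|[set e | [&& a e \in H, b e \in H & p (a e) != p (b e)]]%SET|%:R
      <= c * #|H|%:R].
Proof.
have [n] := ubnP #|H|; elim: n H => // n IH H le_n HX.
have [->|H0] := eqVneq H finset.set0.
  exists id; split=> [x|y|]; rewrite ?inE //.
    by rewrite (_ : [set x in _ | _]%SET = finset.set0) ?cards0 //; apply/setP => x; rewrite !inE.
  rewrite (_ : [set e | _]%SET = finset.set0); last by apply/setP => e; rewrite !inE.
  by rewrite !cards0 mulr0.
have [F [FH F0 FK Fc]] := cut_small HX H0.
have cardH : #|H| = (#|F| + #|H :\: F|)%N.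
  by rewrite -(cardsID F H) (finset.setIidPr FH).
have F_gt0 : (0 < #|F|)%N by rewrite card_gt0.
have [|p [pH pK pc]] := IH (H :\: F)%SET _ (fintype.subset_trans (finset.subsetDl _ _) HX).
  by move: le_n; rewrite cardH; lia.
have [f0 f0F] := finset.set0Pn _ F0.
(* [f0] labels [F]; the labels of the remaining vertices lie outside [F], so no two pieces share a
   label. *)
pose q x := if x \in F then f0 else p x.
exists q; split.
- move=> x xH; rewrite /q; case: ifPn => xF; first exact: (fintype.subsetP FH).
  by have := pH x; rewrite !inE xF xH => /(_ isT) /andP[].
- move=> y; have [yf|yf] := eqVneq y f0.
    apply: leq_trans FK; apply/subset_leq_card/fintype.subsetP => x; rewrite inE => /andP[xH].
    rewrite /q; case: ifPn => // xF /eqP pxy.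
    by have := pH x; rewrite !inE xF xH pxy yf f0F => /(_ isT).
  apply: leq_trans (pK y); apply/subset_leq_card/fintype.subsetP => x; rewrite !inE => /andP[xH].
  by rewrite /q; case: ifPn => xF; [rewrite eq_sym (negbTE yf)|rewrite xH].
- rewrite cardH natrD mulrDr; apply: le_trans (lerD Fc pc).
  rewrite -natrD ler_nat; apply: leq_trans (leq_card_setU _ _).
  apply/subset_leq_card/fintype.subsetP => e; rewrite !inE => /and3P[aH bH].
  rewrite aH bH /q /=; case: (boolP (a e \in F)) => aF; case: (boolP (b e \in F)) => bF //=.
  by rewrite eqxx.
Qed.

End Greedy.

(** * Level sets with small boundary from property A *)

Section LevelSets.
Variables (R : realType) (L : Type) (G : nat -> flgraph L).
Variables (W : forall n, {set fvertex (G n)}) (d : nat).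
Hypothesis deg_d : forall n (x : fvertex (G n)), (degree x <= d)%N.

(** Otherwise all small subsets of [H] have large cuts, and the layer cake inequality applies to |u
    x y| for each y. Summed over y, it bounds eps (d + 1) |H| by the variation of [u] over the edges
    inside [H], which is at most eps d |H|. *)
Lemma property_A_cut (eps : R) r n u : 0 < eps ->
    finite_property_A W eps r (n := n) u ->
  forall H : {set fvertex (G n)}, H \subset ~: W n -> H != finset.set0 ->
  exists F : {set fvertex (G n)}, [/\ F \subset H, F != finset.set0, (#|F| <= d.+1 ^ r)%N
    & #|[set e : fedge (G n) | [&& fsrc e \in H, ftgt e \in H
          & (fsrc e \in F) != (ftgt e \in F)]]%SET|%:R
      <= eps * d.+1%:R * #|F|%:R].
Proof.
move=> eps_gt0 [u1 ub ueps] H HW H0; apply: contrapT => nF.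
have HnW x : x \in H -> x \notin W n by move=> /(fintype.subsetP HW); rewrite inE.
pose EH := [set e : fedge (G n) | (fsrc e \in H) && (ftgt e \in H)]%SET.
pose w y x := if x \in H then `|u x y| else 0.
have key y : eps * d.+1%:R * (\sum_(x in H) `|u x y|) <=
    \sum_(e in EH) `|u (fsrc e) y - u (ftgt e) y|.
  (* Only vertices within r of y have y in their support, which bounds the size of the level
     sets. *)
  pose A := [set x in H | u x y != 0]%SET.
  have cardA : (#|A| <= d.+1 ^ r)%N.
    apply: leq_trans (gball_card (@deg_d n) r y); apply/subset_leq_card/fintype.subsetP => x.
    rewrite !inE => /andP[/HnW xW /(ub _ _ xW)[p [xp py pr]]]; apply: (@gballC _ (G n)).
    exists p; split=> //; apply: sub_path xp => v z.
    by case/and3P.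
  have wA x : x \notin enum A -> w y x = 0.
    rewrite mem_enum inE negb_and negbK /w => /orP[/negbTE -> //|/eqP ->].
    by rewrite normr0 if_same.
  have w0 x : 0 <= w y x by rewrite /w; case: ifP.
  have := @level_set_cut R _ _ (@fsrc L (G n)) (@ftgt L (G n)) (enum EH) (enum A)
    (enum_uniq _) (eps * d.+1%:R) (w y) _ w0 wA.
  have -> : \sum_(x <- enum A) w y x = \sum_(x in H) `|u x y|.
    rewrite big_enum /= [RHS](bigID (fun x => u x y != 0)) /= [X in _ + X]big1 ?addr0.
      by apply: eq_big => x; rewrite !inE // => /andP[xH _]; rewrite /w xH.
    by move=> x /andP[_]; rewrite negbK => /eqP ->; rewrite normr0.
  move=> lc; apply: le_trans (lc _) _.
    move=> F uF FA; rewrite leNgt; apply/negP => cF; apply: nF.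
    exists [set x in F]%SET; have cardF : #|[set x in F]%SET| = size F.
      by rewrite cardsE; apply/card_uniqP.
    have FH : [set x in F]%SET \subset A.
      by apply/fintype.subsetP => x; rewrite inE => /FA; rewrite mem_enum.
    split.
    - by apply: fintype.subset_trans FH _; apply/fintype.subsetP => x; rewrite inE => /andP[].
    - rewrite -card_gt0 cardF lt0n; apply: contraTneq cF => /size0nil ->.
      by rewrite mulr0 -leNgt.
    - exact: leq_trans (subset_leq_card FH) cardA.
    - rewrite cardF; apply: le_trans (ltW cF); rewrite ler_nat.
      rewrite /cut_size -size_filter -(card_uniqP _); last by rewrite filter_uniq ?enum_uniq.
      apply/subset_leq_card/fintype.subsetP => e; rewrite !inE mem_filter mem_enum !inE.
      by case/and3P => -> -> ->.
  rewrite big_enum /=; apply: ler_sum => e; rewrite inE => /andP[sH tH].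
  by rewrite /w sH tH; exact: ler_dist_dist.
have : \sum_y eps * d.+1%:R * (\sum_(x in H) `|u x y|) <=
    \sum_y \sum_(e in EH) `|u (fsrc e) y - u (ftgt e) y| by apply: ler_sum => y _; exact: key.
rewrite -mulr_sumr exchange_big /= [leRHS]exchange_big /=.
rewrite (eq_bigr (fun=> 1)) => [|x /HnW/u1 //].
rewrite leNgt => /negP; apply.
have HR : 0 < #|H|%:R :> R by rewrite ltr0n card_gt0.
apply: le_lt_trans (_ : eps * (d * #|H|)%:R < _).
  apply: le_trans (_ : \sum_(e in EH) eps <= _).
    by apply: ler_sum => e; rewrite inE => /andP[/HnW sW /HnW tW]; exact/ltW/ueps.
  rewrite sumr_const -[leLHS]mulr_natr ler_pM2l // ler_nat.
  apply: leq_trans (incident_card (@deg_d n) H); apply/subset_leq_card/fintype.subsetP => e.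
  by rewrite !inE => /andP[-> _].
rewrite sumr_const -mulrA ltr_pM2l // -natrM ltr_nat mulSn.
by rewrite -[X in (X < _)%N]add0n ltn_add2r card_gt0.
Qed.

End LevelSets.

(* Hyperfiniteness asks for the edge densities to converge, so edge sets are
   padded to a prescribed size. *)
Lemma card_superset (T : finType) (A : {set T}) k :
  exists B : {set T}, A \subset B /\ ((#|A| <= k)%N -> (k <= #|T|)%N -> #|B| = k).
Proof.
pose s := take (k - #|A|) (enum (~: A)%SET).
exists (A :|: [set x in s])%SET; split; first exact: finset.subsetUl.
move=> Ak kT.
have us : uniq s by rewrite take_uniq // enum_uniq.
have -> : #|(A :|: [set x in s])%SET| = (#|A| + #|[set x in s]%SET|)%N.
  apply/eqP; rewrite (leq_card_setU A [set x in s]%SET).2 disjoint_sym.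
  apply/pred0P => x; rewrite /= !inE; apply/negP => /andP[/mem_take].
  by rewrite mem_enum inE => /negbTE ->.
rewrite cardsE (card_uniqP us) size_take -cardE.
have := cardsC A; case: ltnP; lia.
Qed.

(** * From almost-A to hyperfiniteness *)

Section Hyperfinite.
Variables (R : realType) (L : Type).

(** The map [p] is constant along the remaining edges, so a component lies in one fibre. *)
Lemma connect_del_edges_card (G : flgraph L) (E : {set fedge G})
    (p : fvertex G -> fvertex G) (K : nat) :
    (forall y, (#|[set x | p x == y]%SET| <= K)%N) ->
    (forall e : fedge G, p (fsrc e) != p (ftgt e) -> e \in E) ->
  forall x, (#|@connect (fvertex G) (adj (G := @del_edges L G [set e | e \in E])) x| <= K)%N.
Proof.
move=> pK pE x; apply: leq_trans (pK (p x)).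
apply/subset_leq_card/fintype.subsetP => y; rewrite inE => /connectP[s + ->].
elim: s x => [|z s IH] x //= /andP[/asboolP[[e eE] /= xz] /IH /eqP ->].
have : p (fsrc e) = p (ftgt e).
  by apply/eqP/negPn/negP => /pE; apply/negP; move/set_mem: eE => /= /negP.
by case: xz => -[<- <-] ->.
Qed.

(** Every vertex is an end of some edge. This guarantees enough edges for the padding. *)
Lemma connected_card_edges (G : flgraph L) : connected_graph G ->
  (1 < #|fvertex G|)%N -> (#|fvertex G| <= 2 * #|fedge G|)%N.
Proof.
move=> Gc G1.
apply: leq_trans (_ : #|[set @fsrc L G e | e in fedge G] :|: [set @ftgt L G e | e in fedge G]|%SET <= _)%N.
  rewrite -cardsT; apply/subset_leq_card/fintype.subsetP => x _.
  have [y xy] : exists y, y != x.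
    have /card_gt1P[a [b [_ _ ab]]] := G1.
    by have [ax|] := eqVneq a x; [exists b; rewrite -ax eq_sym|exists a].
  have [r [[|z p] /= [xp lp _]]] := Gc x y.
    by rewrite lp eqxx in xy.
  case/andP: xp => /asboolP[e ez] _; rewrite inE; apply/orP.
  by case: ez => -[se te]; [left|right]; apply/finset.imsetP; exists e.
apply: leq_trans (leq_card_setU _ _) _.
by rewrite mul2n -addnn leq_add // leq_imset_card.
Qed.

Lemma natrV_cvg (f : nat -> nat) : f @ \oo --> \oo ->
  ((f n)%:R^-1 : R) @[n --> \oo] --> 0.
Proof.
move=> foo.
suff : (n%:R^-1 : R) @[n --> \oo] --> 0 by move=> /(cvg_comp _ _ foo).
by rewrite -cvg_shiftS; exact: cvg_harmonic.
Qed.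

Lemma almost_A_hyperfinite (G : nat -> flgraph L) :
  graph_sequence G -> almost_A R G -> hyperfinite R G.
Proof.
move=> [Gc [d deg_d] Voo] [W [W0 A]] eps eps_gt0.
(* [c0] is the limit density: eps / 2 puts it below eps, and 1 / 4 keeps the padded size below the
   number of edges, eventually at least half the number of vertices. *)
pose c0 : R := Num.min (eps / 2) (1 / 4).
have c0_gt0 : 0 < c0 by rewrite lt_min; apply/andP; split; lra.
have c0_eps : c0 < eps by apply: le_lt_trans (_ : eps / 2 < _); [rewrite ge_min lexx|lra].
have c0_4 : c0 <= 1 / 4 by rewrite ge_min lexx orbT.
have d1 : 0 < d.+1%:R :> R by [].
(* With [e1] the greedy cuts cost at most c0 / 2 per vertex; the other half pays for the edges at
   [W]. *)
pose e1 : R := c0 / 2 / d.+1%:R.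
have e1_gt0 : 0 < e1 by rewrite !divr_gt0.
have [r Hr] := (property_A_finite R W).1 A e1 e1_gt0.
pose K := (d.+1 ^ r)%N.
have K_gt0 : (0 < K)%N by rewrite expn_gt0.
have cut n : exists E0 : {set fedge (G n)},
    #|E0|%:R <= c0 / 2 * #|fvertex (G n)|%:R + (d * #|W n|)%:R :> R /\
    exists q : fvertex (G n) -> fvertex (G n),
      (forall y, (#|[set x | q x == y]%SET| <= K)%N) /\
      forall e : fedge (G n), q (fsrc e) != q (ftgt e) -> e \in E0.
  have [u uA] := Hr n.
  have [p [pX pK pc]] := greedy_partition (property_A_cut deg_d e1_gt0 uA) (fintype.subxx _).
  (* Deleted vertices become singletons: [p] sends the others off [W], so they join no such
     fibre. *)
  pose q x := if x \in W n then x else p x.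
  exists [set e : fedge (G n) | q (fsrc e) != q (ftgt e)]%SET; split; last first.
    exists q; split=> [y|e]; last by rewrite inE.
    have [yW|yW] := boolP (y \in W n).
      apply: leq_trans K_gt0; rewrite -(cards1 y); apply/subset_leq_card/fintype.subsetP => x.
      rewrite !inE /q; case: ifPn => // xW /eqP pxy.
      by have := pX x; rewrite !inE xW pxy yW => /(_ isT).
    apply: leq_trans (pK y); apply/subset_leq_card/fintype.subsetP => x; rewrite !inE /q.
    by case: ifPn => // xW /eqP xy; rewrite -xy xW in yW.
  apply: le_trans (_ : #|[set e | [&& fsrc e \in (~: W n)%SET, ftgt e \in (~: W n)%SET
     & p (fsrc e) != p (ftgt e)]]%SET|%:R + (d * #|W n|)%:R <= _).
    rewrite -natrD ler_nat.
    apply: leq_trans (leq_add (leqnn _) (incident_card (@deg_d n) (W n))).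
    apply: leq_trans (leq_card_setU _ _); apply/subset_leq_card/fintype.subsetP => e.
    rewrite !inE /q; case: (fsrc e \in W n); case: (ftgt e \in W n); rewrite /= ?orbT ?orbF //.
  rewrite lerD2r; apply: le_trans pc _.
  rewrite /e1 divfK ?gt_eqF // ler_pM2l ?divr_gt0 // ler_nat.
  exact: max_card.
pose k n := Num.truncn (c0 * #|fvertex (G n)|%:R).
(* Components must be bounded for every n, but the exact size is asked only where padding can reach
   it, which holds eventually. The summand 1 absorbs the rounding in [k]. *)
pose P n (E : {set fedge (G n)}) :=
  (forall x : fvertex (G n), (#|@connect (fvertex (G n))
     (adj (G := @del_edges L (G n) [set e | e \in E])) x| <= K)%N) /\
  (c0 / 2 * #|fvertex (G n)|%:R + (d * #|W n|)%:R + 1 <= c0 * #|fvertex (G n)|%:R ->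
   (k n <= #|fedge (G n)|)%N -> #|E| = k n).
have k_itv n : (k n)%:R <= c0 * #|fvertex (G n)|%:R < (k n).+1%:R.
  by apply: truncn_itv; rewrite mulr_ge0 // ltW.
have HP n : exists E : {set fedge (G n)}, P n E.
  have [E0 [cE0 [q [qK qE]]]] := cut n.
  have [E [E0E cE]] := card_superset E0 (k n); exists E; split.
    by apply: connect_del_edges_card qK _ => e /qE; exact: (fintype.subsetP E0E).
  move=> small kE; apply: cE => //.
  have /andP[_] := k_itv n; rewrite -natr1 -(ler_nat R) => kn.
  by apply/ltW; move: cE0 small kn; lra.
exists K, (fun n => projT1 (cid (HP n))); split=> //; last first.
  by move=> n; exact: (projT2 (cid (HP n))).1.
exists c0 => //.
have Vinv := natrV_cvg Voo.
apply: (@squeeze_cvgr _ _ _ _ (fun n => c0 - #|fvertex (G n)|%:R^-1) (fun=> c0)).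
- have H1 : (#|W n|%:R / #|fvertex (G n)|%:R * d%:R + #|fvertex (G n)|%:R^-1 : R)
      @[n --> \oo] --> 0.
    have H := cvgD (cvgM W0 (@cvg_cst _ (d%:R : R) _ \oo _)) Vinv.
    by rewrite mul0r addr0 in H; exact: H.
  have c02 : 0 < c0 / 2 by rewrite divr_gt0.
  have H2 := cvgr_lt 0 H1 _ c02.
  have H3 : \forall n \near \oo, (1 < #|fvertex (G n)|)%N := Voo _ (nbhs_infty_gt 1).
  near=> n.
  have V1 : (1 < #|fvertex (G n)|)%N.
    by near: n.
  have V0 : 0 < #|fvertex (G n)|%:R :> R by rewrite ltr0n; apply: ltnW.
  have : #|W n|%:R / #|fvertex (G n)|%:R * d%:R + #|fvertex (G n)|%:R^-1 < c0 / 2.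
    by near: n; exact: H2.
  rewrite -(ltr_pM2r V0) mulrDl mulVf ?gt_eqF // mulrAC divfK ?gt_eqF // -natrM => small.
  have [_ ->] := projT2 (cid (HP n)); last 2 first.
  + by rewrite mulnC; lra.
  + have := connected_card_edges (Gc n) V1; rewrite -(ler_nat R) natrM => VE.
    have /andP[kc _] := k_itv n; rewrite -(ler_nat R).
    have := ler_wpM2r (ltW V0) c0_4; lra.
  have /andP[kc ck] := k_itv n.
  rewrite ler_pdivrMr // kc andbT ler_pdivlMr // mulrBl mulVf ?gt_eqF //.
  by move: ck; rewrite -natr1; lra.
- by have H := cvgB (@cvg_cst _ c0 _ \oo _) Vinv; rewrite subr0 in H; exact: H.
- exact: cvg_cst.
Unshelve. all: by end_near. Qed.

End Hyperfinite.

(** * From hyperfiniteness to Folner sets *)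

Section HyperfiniteFolner.
Variables (R : realType) (Gamma : groupType) (S : {fset Gamma}).

(** A walk from [x] is traced back to the Cayley graph step by step through [chart_tgt] and
    [chart_src]. *)
Lemma chart_surj (G : flgraph S) r x (phi : Gamma -> fvertex G) k v :
    chart r x phi -> (k <= r)%N -> @gball S G k x v ->
  exists2 h, @gball S (Cay S) k 1%g h & phi h = v.
Proof.
move=> [phi1 _ _ tgtP srcP]; elim: k v => [|k IH] v kr.
  by move=> /(@gball0 _ G) <-; exists 1%g => //; exact: gball_center.
move=> /(@gballS _ G)[/(IH _ (ltnW kr))[h kh <-]|[z /(IH _ (ltnW kr))[h kh hz]]].
  by exists h => //; apply: gball_le kh.
case/asboolP => e [[se te]|[se te]].
- exists (h * val (flab e))%g; first exact: cballS_mul.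
  by rewrite -(tgtP k h e kr kh) //; rewrite -se in hz.
- exists (h * (val (flab e))^-1)%g; first exact: cballS_mulV.
  by rewrite -(srcP k h e kr kh) //; rewrite -te in hz.
Qed.

Section Boundary.
Variables (G : flgraph S) (C : {set fvertex G}) (x : fvertex G) (K : nat).
Hypothesis C_ball : forall y, y \in C -> @gball S G K x y.

Definition in_boundary := [set e : fedge G | (ftgt e \in C) && (fsrc e \notin C)]%SET.

(** [F] consists of the inverses of the chart coordinates of [C], which turns a step back along an
    s-edge into left multiplication by s. A point moved out of [F] gives an edge entering [C], and
    distinct points have distinct targets. Radius K + 1 leaves room for the step. *)
Lemma chart_boundary phi : chart K.+1 x phi -> exists F : seq Gamma,
  [/\ uniq F, size F = #|C| & forall s, s \in S ->
     (count (fun h => (s * h)%g \notin F) F <= #|in_boundary|)%N].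
Proof.
move=> cphi.
have [psi psiP] : exists psi : fvertex G -> Gamma, forall y, y \in C ->
    @gball S (Cay S) K 1%g (psi y) /\ phi (psi y) = y.
  have /choice[psi psiP] : forall y, exists h, y \in C ->
      @gball S (Cay S) K 1%g h /\ phi h = y.
    move=> y; have [yC|_] := boolP (y \in C); last by exists 1%g.
    by have [h] := chart_surj cphi (leqnSn K) (C_ball yC); exists h.
  by exists psi => y; exact: psiP.
exists [seq (psi y)^-1%g | y <- enum C]; split.
- rewrite map_inj_in_uniq ?enum_uniq // => y z; rewrite !mem_enum => yC zC /invg_inj yz.
  by rewrite -(psiP y yC).2 yz (psiP z zC).2.
- by rewrite size_map -cardE.
- move=> s sS; rewrite count_map -size_filter -(card_uniqP _); last first.
    exact/filter_uniq/enum_uniq.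
  apply: leq_trans (leq_imset_card (@ftgt S G) _).
  apply/subset_leq_card/fintype.subsetP => y; rewrite mem_filter mem_enum /= => /andP[sy yC].
  have [yK phy] := psiP y yC.
  have sball : @gball S (Cay S) K.+1 1%g (psi y * s^-1)%g.
    exact: (@cballS_mulV Gamma S K (psi y) [` sS]%fset).
  have [_ inj lift _ _] := cphi.
  have [|e [se te _]] := lift (psi y * s^-1)%g [` sS]%fset sball.
    by rewrite /= mulgVK; apply: gball_le yK.
  rewrite /= mulgVK phy in te.
  apply/finset.imsetP; exists e => //; rewrite inE te yC /=.
  apply: contra sy => seC; apply/mapP; exists (fsrc e); first by rewrite mem_enum.
  have [eK phe] := psiP _ seC.
  have -> : psi (fsrc e) = (psi y * s^-1)%g.
    by apply: inj => //; [apply: gball_le eK|rewrite phe].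
  by rewrite invgM invgK.
Qed.

End Boundary.

(* Averaged over x, the ratio #|boundary (C x)| / #|C x| counts every edge of E at
   most once. *)
Lemma component_boundary (G : flgraph S) (E : {set fedge G}) (B : {set fvertex G}) (c : R) :
    #|E|%:R < c * #|B|%:R ->
  let C x := [set y | @connect (fvertex G) (adj (G := @del_edges S G [set e | e \in E])) x y]%SET in
  exists2 x, x \in B & #|in_boundary (C x)|%:R <= c * #|C x|%:R.
Proof.
move=> EB C.
have Csym : connect_sym (adj (G := @del_edges S G [set e | e \in E]) : rel (fvertex G)).
  by apply: sym_connect_sym => y z; exact: adjC.
have CC x y : y \in C x -> C y = C x.
  rewrite inE => xy; apply/setP => z; rewrite !inE.
  by rewrite (same_connect Csym xy).
have xC x : x \in C x by rewrite inE connect0.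
have C_gt0 x : 0 < #|C x|%:R :> R by rewrite ltr0n card_gt0; apply/finset.set0Pn; exists x.
have bE x e : e \in in_boundary (C x) -> e \in E.
  rewrite !inE => /andP[xt]; apply: contraNT => eE.
  apply: connect_trans xt _; apply: connect1; apply/asboolP.
  by exists (exist _ e (mem_set (negP eE))); right.
apply: contrapT => nB.
have big x : x \in B -> c <= #|in_boundary (C x)|%:R / #|C x|%:R.
  move=> xB; rewrite ler_pdivlMr // leNgt; apply/negP => small; apply: nB.
  by exists x => //; exact: ltW.
have : c * #|B|%:R <= #|E|%:R.
  rewrite mulrC mulr_natl -sumr_const; apply: le_trans (ler_sum _ big) _.
  apply: le_trans (_ : \sum_x \sum_(e in E) (e \in in_boundary (C x))%:R / #|C x|%:R <= _).
    rewrite big_mkcond; apply: ler_sum => x _.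
    have -> : \sum_(e in E) (e \in in_boundary (C x))%:R / #|C x|%:R =
        #|in_boundary (C x)|%:R / #|C x|%:R :> R.
      rewrite -mulr_suml -natr_sum; congr (_%:R / _).
      rewrite -sum1_card big_mkcond [RHS]big_mkcond /=; apply: eq_bigr => e _.
      by case: (boolP (e \in in_boundary (C x))) => [/bE -> //|_]; rewrite if_same.
    by case: ifP => // _; rewrite divr_ge0.
  rewrite exchange_big /= -sum1_card natr_sum; apply: ler_sum => e _.
  apply: le_trans (_ : \sum_(x in C (ftgt e)) #|C (ftgt e)|%:R^-1 <= _); last first.
    by rewrite sumr_const -[leLHS]mulr_natr mulVf // gt_eqF.
  rewrite [leRHS]big_mkcond; apply: ler_sum => x _.
  case: (boolP (e \in in_boundary (C x))) => eC; last first.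
    by rewrite mul0r; case: ifP => // _; rewrite invr_ge0.
  have tC : ftgt e \in C x by move: eC; rewrite inE => /andP[].
  by rewrite (CC _ _ tC) xC mul1r.
by rewrite leNgt EB.
Qed.

Lemma hyperfinite_folner (G : nat -> flgraph S) :
  sofic_approximation R G -> hyperfinite R G -> folner R S.
Proof.
move=> [_ sofic] hyp eps eps_gt0.
(* Eventually more than half of the vertices have Cayley balls, so a bound by eps / 2 per vertex
   becomes one by eps per vertex of [B n]. *)
have eps2 : 0 < eps / 2 by rewrite divr_gt0.
have [K [E [K_gt0 [l El l_eps] EK]]] := hyp _ eps2.
pose B n := [set x | `[< @gball_iso S K.+1 (G n) x (Cay S) 1%g >]]%SET.
have H1 := cvgr_lt _ El _ l_eps.
have half : 1 / 2 < 1 :> R by lra.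
have H2 := cvgr_gt _ (sofic K.+1) _ half.
have [n [En Bn]] : exists n, #|E n|%:R / #|fvertex (G n)|%:R < eps / 2 /\
    1 / 2 < #|B n|%:R / #|fvertex (G n)|%:R :> R.
  near \oo => n; exists n; split; near: n; [exact: H1|exact: H2].
have V0 : 0 < #|fvertex (G n)|%:R :> R.
  rewrite lt_def ler0n andbT; apply: contraTneq Bn => ->.
  by rewrite invr0 mulr0 -leNgt divr_ge0.
have EB : #|E n|%:R < eps * #|B n|%:R.
  rewrite ltr_pdivrMr // in En; rewrite ltr_pdivlMr // in Bn.
  have := ltr_pM2l eps_gt0 (1 / 2 * #|fvertex (G n)|%:R) #|B n|%:R; rewrite Bn; lra.
have [x xB xC] := component_boundary EB.
set C := [set y | _]%SET in xC.
have CK : (#|C| <= K)%N by rewrite cardsE; exact: EK.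
(* A path without repetitions stays in the component, hence has fewer than [K] steps. *)
have Cball y : y \in C -> @gball S (G n) K x y.
  rewrite inE => /connectP[p0 xp0 ->]; case/shortenP: xp0 => p xp up _.
  exists p; split=> //.
    apply: sub_path xp => v z /asboolP[[e ?] ?]; apply/asboolP.
    by exists e.
  apply: leq_trans CK; apply: ltnW; rewrite -[X in (X <= _)%N]/(size (x :: p)).
  rewrite -(card_uniqP up); apply/subset_leq_card/fintype.subsetP => z zp.
  rewrite inE; case/splitPl: (zp) xp => p1 p2 <-; rewrite cat_path => /andP[xp1 _].
  by apply/connectP; exists p1.
have [phi cphi] : exists phi, chart K.+1 x phi.
  by apply: gball_iso_chart; move: xB; rewrite inE => /asboolP.
have [F [uF sF Fs]] := chart_boundary Cball cphi.
exists F; split=> //.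
  have : (0 < #|C|)%N by rewrite card_gt0; apply/finset.set0Pn; exists x; rewrite inE connect0.
  by rewrite -sF; case: (F).
by move=> s sS; rewrite sF; apply: le_trans xC; rewrite ler_nat; exact: Fs.
Unshelve. all: by end_near. Qed.

End HyperfiniteFolner.

(** * Property A from slowly varying finite sets *)

(* A x plays the role of the support x F, and y in A x is moved to the root of the
   component of x in {z | y \in A z}. *)
Section RootedComponents.
Variables (R : realType) (L : Type) (G : nat -> flgraph L).
Variables (W : forall n, {set fvertex (G n)}) (n : nat).
Variables (A : fvertex (G n) -> {set fvertex (G n)}) (c K : nat) (eps : R).
Hypothesis c_gt0 : forall x, x \notin W n -> (0 < c)%N.
Hypothesis cardA : forall x, x \notin W n -> #|A x| = c.
Hypothesis diffA : forall e : fedge (G n), fsrc e \notin W n -> ftgt e \notin W n ->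
  (#|A (fsrc e) :\: A (ftgt e)|%SET + #|A (ftgt e) :\: A (fsrc e)|%SET)%:R < eps * c%:R.
Hypothesis cardK : forall y, (#|[set x | (x \notin W n) && (y \in A x)]%SET| <= K)%N.

Let comp_rel y : rel (fvertex (G n)) := fun x z =>
  [&& walk_avoiding W x z, y \in A x & y \in A z].

Let comp_sym y : connect_sym (comp_rel y).
Proof.
apply: sym_connect_sym => x z; rewrite /comp_rel /walk_avoiding adjC.
by rewrite [(x \notin _) && _]andbC [(y \in A x) && _]andbC.
Qed.

Let rt y x := fingraph.root (comp_rel y) x.

(** A point common to the sets of two adjacent vertices has the same root for both, so only the
    symmetric difference contributes to the variation. *)
Lemma rooted_components : exists u, finite_property_A W eps K (n := n) u.
Proof.
pose u x v : R := (\sum_(y in A x) (rt y x == v)%:R) / c%:R.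
have u0 x v : 0 <= u x v by rewrite divr_ge0 // sumr_ge0.
have sum_rt (X : {set fvertex (G n)}) x :
    \sum_v \sum_(y in X) (rt y x == v)%:R = #|X|%:R :> R.
  rewrite exchange_big /= -sum1_card natr_sum; apply: eq_bigr => y _.
  rewrite (bigD1 (rt y x)) //= eqxx big1 ?addr0 // => v vy.
  by rewrite eq_sym (negbTE vy).
exists u; split.
- move=> x xW; under eq_bigr => v _ do rewrite ger0_norm //.
  rewrite -mulr_suml sum_rt cardA // divff // pnatr_eq0 -lt0n; exact: c_gt0 xW.
- move=> x v xW uxv.
  have [y yA yv] : exists2 y, y \in A x & rt y x = v.
    apply: contrapT => nyv; move/eqP: uxv; apply.
    rewrite /u big1 ?mul0r // => y yA; case: eqP => // yv.
    by case: nyv; exists y.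
  have : connect (comp_rel y) x v by rewrite -yv; exact: connect_root.
  (* A path to the root without repetitions runs through a set of at most [K] vertices off [W]. *)
  case/connectP => p0 xp0 ->; case/shortenP: xp0 => p xp up _.
  exists p; split=> //; first by apply: sub_path xp => a b /andP[].
  apply: leq_trans (cardK y); apply: ltnW.
  rewrite -[X in (X <= _)%N]/(size (x :: p)) -(card_uniqP up).
  apply/subset_leq_card/fintype.subsetP => z; rewrite inE => /orP[/eqP -> |zp].
    by rewrite xW yA.
  case/splitPr: zp xp => p1 p2; rewrite cat_path /= => /and3P[_ + _].
  by case/and3P => /and3P[_ _ ->] _ ->.
- move=> e sW tW.
  set x := fsrc e; set z := ftgt e.
  have c0 : 0 < c%:R :> R by rewrite ltr0n (c_gt0 sW).
  have rt_eq y : y \in A x -> y \in A z -> rt y x = rt y z.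
    move=> yx yz; apply/(fingraph.rootP (comp_sym y)); apply: connect1.
    by rewrite /comp_rel /walk_avoiding yx yz sW tW !andbT; exact: (@adj_edge _ (G n)).
  have split_u (a b : fvertex (G n)) v : u a v =
      (\sum_(y in A a :&: A b) (rt y a == v)%:R + \sum_(y in A a :\: A b) (rt y a == v)%:R) / c%:R.
    by rewrite /u (big_setID (A b)).
  apply: le_lt_trans (_ : (#|A x :\: A z|%SET + #|A z :\: A x|%SET)%:R / c%:R < _); last first.
    by rewrite ltr_pdivrMr // diffA.
  rewrite natrD -(sum_rt _ x) -(sum_rt _ z) -big_split /= mulr_suml.
  apply: ler_sum => v _; rewrite (split_u x z) (split_u z x) finset.setIC.
  rewrite (eq_bigr (fun y => (rt y z == v)%:R)); last first.
    by move=> y; rewrite inE => /andP[yz yx]; rewrite rt_eq.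
  rewrite -mulrBl normrM (@ger0_norm _ c%:R^-1) ?invr_ge0 // ler_wpM2r ?invr_ge0 //.
  rewrite opprD addrACA subrr add0r; apply: le_trans (ler_normB _ _) _.
  by rewrite !ger0_norm ?sumr_ge0.
Qed.

End RootedComponents.

(** * Cayley balls and change of chart *)

Section CayleyBalls.
Variables (Gamma : groupType) (S : {fset Gamma}).
Local Notation cball r := (@gball S (Cay S) r 1%g).

Lemma cball_mul r k (g h : Gamma) : cball r g -> cball k h -> cball (r + k) (g * h)%g.
Proof.
move=> rg; move: k h; apply: cball_ind.
- by rewrite addn0 mulg1.
- by move=> k h; apply: gball_le; rewrite leq_add2l.
- by move=> k h s _ IH; rewrite addnS mulgA; exact: cballS_mul.
- by move=> k h s _ IH; rewrite addnS mulgA; exact: cballS_mulV.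
Qed.

Lemma cball_gen (s : S) : cball 1 (val s).
Proof. by rewrite -[val s]mul1g; apply: cballS_mul; exact: gball_center. Qed.

Lemma cball_genV (s : S) : cball 1 (val s)^-1%g.
Proof. by rewrite -[(val s)^-1%g]mul1g; apply: cballS_mulV; exact: gball_center. Qed.

Lemma cball_inv r (g : Gamma) : cball r g -> cball r g^-1%g.
Proof.
move: r g; apply: cball_ind.
- by rewrite invg1; exact: gball_center.
- by move=> k h; apply: gball_le.
- by move=> k h s _ IH; rewrite invgM -add1n; apply: cball_mul IH; exact: cball_genV.
- by move=> k h s _ IH; rewrite invgM invgK -add1n; apply: cball_mul IH; exact: cball_gen.
Qed.

Lemma cball_exhaust : generates S -> forall g, exists r, cball r g.
Proof.
move=> S_gen g; apply/asboolP.
apply: (S_gen (fun g => `[< exists r, cball r g >])).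
  split; first by apply/asboolP; exists 0%N; exact: gball_center.
  move=> u v /asboolP[r ru] /asboolP[k kv]; apply/asboolP; exists (r + k)%N.
  by apply: cball_mul => //; exact: cball_inv.
by move=> s sS; apply/asboolP; exists 1%N; exact: (cball_gen [` sS]%fset).
Qed.

Lemma cball_exhaust_seq : generates S -> forall F : seq Gamma,
  exists r, forall g, g \in F -> cball r g.
Proof.
move=> S_gen; elim=> [|g F [r rF]]; first by exists 0%N.
have [k kg] := cball_exhaust S_gen g; exists (maxn r k) => h.
rewrite inE => /orP[/eqP ->|/rF rh].
  exact: gball_le (leq_maxr r k) kg.
exact: gball_le (leq_maxl r k) rh.
Qed.

(** Both sides follow labelled edges and agree at 1, where they give the target of [e]. The bound on
    k is strict because the label can move h one step further from 1. *)
Lemma chart_shift (G : flgraph S) r (e : fedge G) (phi psi : Gamma -> fvertex G) k h :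
    chart r (fsrc e) phi -> chart r (ftgt e) psi -> cball k h -> (k < r)%N ->
  psi h = phi (val (flab e) * h)%g.
Proof.
move=> [phi1 _ _ tgtP srcP] [psi1 _ lift _ _]; move: k h; apply: cball_ind.
- move=> r0; rewrite psi1 mulg1 (tgtP 0%N 1%g) ?mul1g //; exact: gball_center.
- by move=> k h IH kr; apply: IH; exact: ltnW.
- move=> k h s kh IH kr.
  have [||e' [se <- le]] := lift h s.
  + by apply: gball_le kh; rewrite ltnW // ltnW.
  + by apply: (gball_le (ltnW kr)); exact: cballS_mul.
  + rewrite (tgtP k.+1 (val (flab e) * h)%g) ?le ?mulgA //.
      by rewrite -add1n; apply: cball_mul => //; exact: cball_gen.
    by rewrite se IH // ltnW.
- move=> k h s kh IH kr.
  have [||e' [<- te le]] := lift (h * (val s)^-1)%g s.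
  + by apply: (gball_le (ltnW kr)); exact: cballS_mulV.
  + by rewrite mulgVK; apply: gball_le kh; rewrite ltnW // ltnW.
  + rewrite (srcP k.+1 (val (flab e) * h)%g) ?le ?mulgA //.
      by rewrite -add1n; apply: cball_mul => //; exact: cball_gen.
    by rewrite te mulgVK IH // ltnW.
Qed.

End CayleyBalls.

(** * From Folner sets to almost-A *)

Section FolnerAlmostA.
Variables (R : realType) (Gamma : groupType) (S : {fset Gamma}).
Hypothesis S_gen : generates S.
Variable G : nat -> flgraph S.
Hypothesis G_sofic : sofic_approximation R G.

Definition chartless r n : {set fvertex (G n)} :=
  [set x | ~~ `[< exists phi, chart r x phi >]]%SET.

Lemma chartless_cvg r : ((#|chartless r n|%:R / #|fvertex (G n)|%:R) : R) @[n --> \oo] --> 0.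
Proof.
have [_ /(_ r) good] := G_sofic.
have H := cvgB (@cvg_cst _ (1 : R) _ \oo _) good; rewrite subrr in H.
have H1 := cvgr_gt _ good _ (@ltr01 R).
apply: (@squeeze_cvgr _ _ _ _ (fun=> 0) (fun n =>
  1 - #|[set x | `[< @gball_iso S r (G n) x (Cay S) 1%g >]]%SET|%:R
       / #|fvertex (G n)|%:R)); [|exact: cvg_cst|exact: H].
near=> n; rewrite divr_ge0 //=.
have V0 : 0 < #|fvertex (G n)|%:R :> R.
  have : 0 < #|[set x | `[< @gball_iso S r (G n) x (Cay S) 1%g >]]%SET|%:R
       / #|fvertex (G n)|%:R :> R by near: n; exact: H1.
  rewrite ltr0n; apply: contraTT; rewrite -eqn0Ngt => /eqP ->.
  by rewrite invr0 mulr0 ltxx.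
rewrite ler_pdivrMr // mulrBl mul1r divfK ?gt_eqF // lerBrDr -natrD ler_nat.
rewrite -[leqRHS](cardsC (chartless r n)) leq_add2l.
apply/subset_leq_card/fintype.subsetP => x; rewrite !inE negbK.
by move=> /gball_iso_chart ex; apply/asboolP.
Unshelve. all: by end_near. Qed.

(** The union over radii gives a vertex outside it charts of every radius up to [m], so no chart has
    to be restricted to a smaller ball. *)
Definition bad m n : {set fvertex (G n)} := \bigcup_(j < m.+1) chartless j n.

Lemma bad_cvg m : ((#|bad m n|%:R / #|fvertex (G n)|%:R) : R) @[n --> \oo] --> 0.
Proof.
apply: (@squeeze_cvgr _ _ _ _ (fun=> 0)
  (fun n => \sum_(j < m.+1) (#|chartless j n|%:R / #|fvertex (G n)|%:R))).
- near=> n; rewrite divr_ge0 //= -mulr_suml ler_wpM2r ?invr_ge0 //.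
  by rewrite -natr_sum ler_nat; exact: leq_card_bigcup.
- exact: cvg_cst.
- elim: m.+1 => [|M IH].
    suff -> : (fun n => \sum_(j < 0) (#|chartless j n|%:R / #|fvertex (G n)|%:R)) =
      fun=> 0 :> R by exact: cvg_cst.
    by apply/funext => n; rewrite big_ord0.
  have H := cvgD IH (chartless_cvg M); rewrite addr0 in H.
  suff -> : (fun n => \sum_(j < M.+1) (#|chartless j n|%:R / #|fvertex (G n)|%:R)) =
    (fun n => \sum_(j < M) (#|chartless j n|%:R / #|fvertex (G n)|%:R) +
       #|chartless M n|%:R / #|fvertex (G n)|%:R) :> (nat -> R) by exact: H.
  by apply/funext => n; rewrite big_ord_recr.
Unshelve. all: by end_near. Qed.

Definition small m n := (#|bad m n|%:R <= m.+1%:R^-1 * #|fvertex (G n)|%:R :> R).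

(* The deepest level whose bad set is still sparse; level 0 always qualifies. *)
Definition depth n : nat := [arg max_(m > (ord0 : 'I_n.+1) | small m n) m].

Lemma depth_small n : small (depth n) n.
Proof.
rewrite /depth; case: arg_maxnP => //.
by rewrite /small invr1 mul1r ler_nat max_card.
Qed.

Lemma depth_ge m : \forall n \near \oo, (m <= depth n)%N.
Proof.
have m0 : 0 < m.+1%:R^-1 :> R by rewrite invr_gt0.
have H1 := cvgr_lt _ (bad_cvg m) _ m0.
near=> n.
have mn : (m < n.+1)%N by rewrite ltnS; near: n; exact: nbhs_infty_ge.
rewrite /depth; case: arg_maxnP => [|i _ /(_ (Ordinal mn))].
  by rewrite /small invr1 mul1r ler_nat max_card.
apply; rewrite /small /=.
have : #|bad m n|%:R / #|fvertex (G n)|%:R < m.+1%:R^-1 :> R by near: n; exact: H1.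
have [V0|V0] := eqVneq #|fvertex (G n)| 0%N.
  by move=> _; rewrite V0 mulr0 lern0 -leqn0 -V0 max_card.
by rewrite ltr_pdivrMr ?ltr0n ?lt0n // => /ltW.
Unshelve. all: by end_near. Qed.

(** The deleted sets are fixed before eps, hence before the radius of the Folner set. Growing depth
    serves every radius up to finitely many graphs. *)
Lemma folner_almost_A : folner R S -> almost_A R G.
Proof.
move=> fol; exists (fun n => bad (depth n) n); split.
  apply: (@squeeze_cvgr _ _ _ _ (fun=> 0) (fun n => (depth n).+1%:R^-1)).
  - near=> n; rewrite divr_ge0 //=.
    have := depth_small n; rewrite /small.
    have [->|V0] := eqVneq #|fvertex (G n)| 0%N.
      by move=> _; rewrite invr0 mulr0 invr_ge0.
    by rewrite ler_pdivrMr // ltr0n lt0n.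
  - exact: cvg_cst.
  - apply: (@natrV_cvg R (fun n => (depth n).+1)); apply/cvgnyPge => m.
    by near=> n; apply: leqW; near: n; exact: depth_ge.
have [[_ [d deg_d] _] _] := G_sofic.
apply/property_A_finite => eps eps_gt0.
(* Two differences of at most eps / 4 per point of [F] stay strictly below eps in total. *)
have eps4 : 0 < eps / 4 by rewrite divr_gt0.
have [F [uF F0 Fs]] := fol _ eps4.
have [l Fl] := cball_exhaust_seq S_gen F.
have [N _ HN] := depth_ge l.+1.
pose K := maxn (d.+1 ^ l) (\max_(n < N) #|fvertex (G n)|).
exists K => n.
have [Nn|nN] := leqP N n; last first.
  (* In the finitely many early graphs the whole vertex set serves every vertex, so nothing varies;
     the maximum in [K] covers them. *)
  apply: (@rooted_components _ _ _ _ n (fun=> [set: fvertex (G n)]%SET) #|fvertex (G n)|).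
  - by move=> x _; apply/card_gt0P; exists x.
  - by move=> x _; rewrite cardsT.
  - move=> e _ _; rewrite finset.setDv cards0 addn0 mulr_gt0 // ltr0n.
    by apply/card_gt0P; exists (fsrc e).
  - move=> y; apply: leq_trans (max_card _) _; apply: leq_trans (leq_maxr _ _).
    exact: (leq_bigmax (Ordinal nN)).
have chartP x : exists phi, x \notin bad (depth n) n -> chart l.+1 x phi.
  have [xb|xb] := boolP (x \in bad (depth n) n); first by exists (fun=> x).
  suff [phi cphi] : exists phi, chart l.+1 x phi by exists phi.
  apply: contrapT => nphi; move/negP: xb; apply; apply/finset.bigcupP.
  have ld : (l.+1 < (depth n).+1)%N by rewrite ltnS; exact: HN.
  by exists (Ordinal ld) => //; rewrite inE; apply/asboolPn.
have [phi phiP] := choice chartP.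
pose A x := [set y in [seq phi x g | g <- F]]%SET.
have uA x : x \notin bad (depth n) n -> uniq [seq phi x g | g <- F].
  move=> /phiP [_ inj _ _ _]; rewrite map_inj_in_uniq // => g h gF hF.
  by apply: inj; apply: gball_le (leqnSn l) _; exact: Fl.
have F_gt0 : (0 < size F)%N by case: (F) F0.
apply: (@rooted_components _ _ _ _ n A (size F)).
- by [].
- by move=> x xb; rewrite cardsE (card_uniqP (uA x xb)) size_map.
- move=> e sb tb.
  have cs := phiP _ sb; have ct := phiP _ tb.
  set s := flab e.
  have shift g : g \in F -> phi (ftgt e) g = phi (fsrc e) (val s * g)%g.
    by move=> gF; exact: chart_shift cs ct (Fl g gF) (ltnSn l).
  (* In the chart at the source, [A (ftgt e)] is the image of s F, which misses g when s^-1 g is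
     outside [F]; hence [defectV]. *)
  have d1 : (#|A (fsrc e) :\: A (ftgt e)|%SET <= defect F (val s))%N.
    rewrite -(defectV (val s) uF) /defect -size_filter.
    rewrite -(size_map (phi (fsrc e))) -[leqRHS]/(size _).
    apply: leq_trans (card_size _); apply/subset_leq_card/fintype.subsetP => y.
    rewrite !inE => /andP[yt /mapP[g gF yg]]; apply/mapP; exists g => //.
    rewrite mem_filter gF andbT; apply: contra yt => sgF.
    by apply/mapP; exists ((val s)^-1 * g)%g => //; rewrite shift // mulVKg.
  have d2 : (#|A (ftgt e) :\: A (fsrc e)|%SET <= defect F (val s))%N.
    rewrite /defect -size_filter -(size_map (phi (ftgt e))).
    apply: leq_trans (card_size _); apply/subset_leq_card/fintype.subsetP => y.
    rewrite !inE => /andP[ys /mapP[g gF yg]]; apply/mapP; exists g => //.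
    rewrite mem_filter gF andbT; apply: contra ys => sgF.
    by apply/mapP; exists (val s * g)%g => //; rewrite yg shift.
  have := Fs _ (valP s); rewrite -[count _ _]/(defect F (val s)).
  have Fpos : 0 < eps * (size F)%:R by rewrite mulr_gt0 // ltr0n.
  have := leq_add d1 d2; rewrite -(ler_nat R) [leRHS]natrD; lra.
- move=> y; apply: leq_trans (leq_maxl _ _).
  apply: leq_trans (gball_card (@deg_d n) l y).
  apply/subset_leq_card/fintype.subsetP => x; rewrite !inE => /andP[xb /mapP[g gF ->]].
  apply: (@gballC _ (G n)).
  rewrite -{1}(chart1 (phiP _ xb)).
  exact: lift_ball (chart_lift (phiP _ xb)) (Fl g gF) (leqnSn l).
Unshelve. all: by end_near. Qed.

End FolnerAlmostA.

Theorem theorem0p7 (R : realType) (Gamma : groupType) (S : {fset Gamma})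
    (S_gen : generates S) (G : nat -> flgraph S)
    (G_sofic : sofic_approximation R G) :
  (amenable Gamma R <-> almost_A R G) /\ (almost_A R G <-> hyperfinite R G).
Proof.
have A_hyp : almost_A R G -> hyperfinite R G := almost_A_hyperfinite G_sofic.1.
have hyp_am : hyperfinite R G -> amenable Gamma R.
  by move=> /(hyperfinite_folner G_sofic)/(folner_amenable S_gen).
have am_A : amenable Gamma R -> almost_A R G.
  by move=> /(@amenable_folner _ _ S)/(folner_almost_A S_gen G_sofic).
split; split=> //; last by move=> H; exact: am_A (hyp_am H).
by move=> H; exact: hyp_am (A_hyp H).
Qed.
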